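(* There exists a non-adaptive $\varepsilon$-distance estimator for the class of $k$-juntas that makes at most \[ \mathrm{poly}(k,\varepsilon^{-1})\cdot 2^{\widetilde{O}\left(\sqrt{k\log(1/\varepsilon)}\right)} \] queries (independently of $n$), where the $\widetilde{O}(\cdot)$ notation hides factors polylogarithmic in $k$ and in $\log(1/\varepsilon)$ (i.e. $\log(k)$ and $\log\log(1/\varepsilon)$ factors).
   Context: For Boolean functions $f,g:\{-1,1\}^n\to\{-1,1\}$, $\mathrm{dist}(f,g):=\Pr_{\mathbf{x}\sim\{-1,1\}^n}[f(\mathbf{x})\neq g(\mathbf{x})]$ with $\mathbf{x}$ uniform, and for a class $\mathcal{C}$, $\mathrm{dist}(f,\mathcal{C}):=\min_{g\in\mathcal{C}}\mathrm{dist}(f,g)$. A function $f:\{-1,1\}^n\to\{-1,1\}$ is a $k$-junta if there are indices $i_1,\dots,i_k\in[n]$ and a function $g$ with $f(x)=g(x_{i_1},\dots,x_{i_k})$ for all $x$; $\mathcal{J}_k$ denotes the class of $k$-juntas on $n$ variables. An $\varepsilon$-distance estimator for $k$-juntas is a (randomized) algorithm which, given $k$, $\varepsilon\in(0,1/2]$ and query (black-box) access to an arbitrary $f:\{-1,1\}^n\to\{-1,1\}$, outputs a number that with probability at least $2/3$ lies within additive error $\varepsilon$ of $\mathrm{dist}(f,\mathcal{J}_k)$. It is non-adaptive if the points at which it queries $f$ are chosen independently of the answers to its queries (i.e. independently of $f$). *)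

(* Defs.v *)
From HB Require Import structures.
From mathcomp Require Import all_boot all_order all_algebra.
From mathcomp Require Import reals exp.

Set Implicit Arguments.
Unset Strict Implicit.
Unset Printing Implicit Defensive.

Import Order.TTheory GRing.Theory Num.Theory.
Local Open Scope ring_scope.

(* The two-element set {-1,1} is represented by bool: distances, juntas and
   query algorithms only ever test its elements for equality. *)
Notation cube n := {ffun 'I_n -> bool}.
Notation boolfun n := {ffun cube n -> bool}.

Definition dist (R : realType) (n : nat) (f g : boolfun n) : R :=
  #|[set x : cube n | f x != g x]|%:R / #|{: cube n}|%:R.

(* Distances are at most 1, so the default value 1 is neutral for the minimum
   over a nonempty class. The class of k-juntas below is empty only for
   n = 0 < k, where no index exists. *)
Definition dist_class (R : realType) (n : nat) (f : boolfun n)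
    (C : pred (boolfun n)) : R :=
  \big[Num.min/1]_(g : boolfun n | C g) dist R f g.

(* The indices i_1, ..., i_k need not be distinct. *)
Definition junta (n k : nat) : pred (boolfun n) := fun f =>
  [exists i : {ffun 'I_k -> 'I_n}, exists g : boolfun k,
     forall x : cube n, f x == g [ffun j => x (i j)]].
Arguments junta : clear implicits.

(* Deterministic, possibly adaptive, query algorithms; [Query x t1 t0] asks for
   the value at x and proceeds as t1 if it is true and as t0 otherwise. *)
Inductive query_tree (R : Type) (n : nat) : Type :=
  | Output of R
  | Query of cube n & query_tree R n & query_tree R n.

Fixpoint run (R : Type) (n : nat) (t : query_tree R n) (f : boolfun n) : R :=
  match t with
  | Output r => r
  | Query x t1 t0 => run (if f x then t1 else t0) f
  end.

Fixpoint queried (R : Type) (n : nat) (t : query_tree R n) (f : boolfun n) :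
    seq (cube n) :=
  match t with
  | Output _ => [::]
  | Query x t1 t0 => x :: (if f x then queried t1 f else queried t0 f)
  end.

(* A randomized algorithm is a finitely supported probability distribution over
   deterministic ones; the seed is all of its internal randomness. *)
Record rand_algo (R : realType) (n : nat) := RandAlgo {
  seed : finType;
  weight : seed -> R;
  weight_ge0 : forall w, 0 <= weight w;
  weight_sum1 : \sum_w weight w = 1;
  algo : seed -> query_tree R n }.

Definition prob (R : realType) (n : nat) (A : rand_algo R n)
    (E : pred (seed A)) : R := \sum_(w | E w) weight w.

Definition nonadaptive (R : realType) (n : nat) (A : rand_algo R n) : Prop :=
  forall (w : seed A) (f g : boolfun n),
    queried (algo w) f = queried (algo w) g.

Definition makes_at_most (R : realType) (n : nat) (A : rand_algo R n) (q : R) :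
    Prop :=
  forall (w : seed A) (f : boolfun n), (size (queried (algo w) f))%:R <= q.

Definition distance_estimator (R : realType) (n : nat) (C : pred (boolfun n))
    (eps : R) (A : rand_algo R n) : Prop :=
  forall f : boolfun n,
    2 / 3 <= prob (fun w : seed A =>
                     `|run (algo w) f - dist_class R f C| <= eps).

Definition log2 (R : realType) (x : R) : R := ln x / ln 2.

(* poly(k, 1/eps): since 1/eps >= 2, every polynomial in k and 1/eps is at most
   (k + 1/eps)^a for some a. *)
Definition poly_factor (R : realType) (a k : nat) (eps : R) : R :=
  (k%:R + eps^-1) ^+ a.

(* O~(sqrt (k log(1/eps))). For eps <= 1/2, log2 (log2 (1/eps)) >= 0; the
   summand 1 keeps the polylogarithmic factor from vanishing at k = 1,
   eps = 1/2. For k = 0 the square root vanishes and ln 0 is irrelevant. *)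
Definition soft_exponent (R : realType) (b c k : nat) (eps : R) : R :=
  b%:R * Num.sqrt (k%:R * log2 eps^-1)
       * (1 + log2 k%:R + log2 (log2 eps^-1)) ^+ c.

(* Main.v *)
(* Juntas are compared through the correlations E_x |E[f | x_S]|, since the
   distance from f to the juntas on S is half of one minus this quantity.
   Hashing the coordinates at random into polynomially many blocks replaces the
   sets S by unions U of k blocks: a block may contain many coordinates, but
   with high probability all but its most influential one contribute little to
   E[f | x_U], uniformly in U.

   To estimate E[f | x_U] at x for all U at once, query f at noisy copies of x
   in which every block survives with probability beta^i, beta = 1 - 1/(2k+2),
   i = 0..D, and keep those copies in which U survives. A Fourier character
   meeting j blocks outside U is then damped by beta^(ij), so a linear
   combination of these averages with the coefficients of a polynomial p damps
   it by p(beta^j). A polynomial of degree D = O~(sqrt (k log (1/eps))) + O(log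
   (1/eps)) with p(1) = 1 and |p(beta^j)| <= eps for all j >= 1 has exactly the
   desired effect; its coefficients, and the inverse of the probability that U
   survives, are 2^(O~(D)), which bounds the number of samples. *)
Require Import Defs.
From HB Require Import structures.
From mathcomp Require Import all_boot all_order all_algebra.
From mathcomp Require Import reals exp.
From mathcomp Require Import boolp sequences zify ring lra.

Set Implicit Arguments.
Unset Strict Implicit.
Unset Printing Implicit Defensive.

Import Order.TTheory GRing.Theory Num.Theory.
Local Open Scope ring_scope.

(** * Uniform averages over finite types *)

Section Average.
Variable R : realType.
Implicit Types T : finType.

(* The mean over the empty type is the junk value 0. *)
Definition avg T (F : T -> R) : R := (\sum_t F t) / #|T|%:R.

Lemma eq_avg T (F G : T -> R) : F =1 G -> avg F = avg G.
Proof. by move=> FG; rewrite /avg (eq_bigr G). Qed.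

Lemma avgD T (F G : T -> R) : avg (fun t => F t + G t) = avg F + avg G.
Proof. by rewrite /avg big_split mulrDl. Qed.

Lemma avgN T (F : T -> R) : avg (fun t => - F t) = - avg F.
Proof. by rewrite /avg sumrN mulNr. Qed.

Lemma avgB T (F G : T -> R) : avg (fun t => F t - G t) = avg F - avg G.
Proof. by rewrite avgD avgN. Qed.

Lemma avgZ T c (F : T -> R) : avg (fun t => c * F t) = c * avg F.
Proof. by rewrite /avg -mulr_sumr mulrA. Qed.

Lemma avg_sum T (I : finType) (P : pred I) (F : I -> T -> R) :
  avg (fun t => \sum_(i | P i) F i t) = \sum_(i | P i) avg (F i).
Proof. by rewrite /avg exchange_big mulr_suml. Qed.

Lemma avg_const T (c : R) : (0 < #|T|)%N -> avg (fun _ : T => c) = c.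
Proof.
move=> T0; rewrite /avg sumr_const -[c *+ _]mulr_natr mulfK // pnatr_eq0.
by rewrite -lt0n.
Qed.

Lemma ler_avg T (F G : T -> R) : (forall t, F t <= G t) -> avg F <= avg G.
Proof.
by move=> FG; rewrite ler_wpM2r ?invr_ge0 ?ler0n // ler_sum.
Qed.

Lemma avg_ge0 T (F : T -> R) : (forall t, 0 <= F t) -> 0 <= avg F.
Proof.
by move=> F0; rewrite mulr_ge0 ?invr_ge0 ?ler0n // sumr_ge0.
Qed.

Lemma ler_norm_avg T (F : T -> R) : `|avg F| <= avg (fun t => `|F t|).
Proof.
rewrite normrM normfV normr_nat ler_wpM2r ?invr_ge0 ?ler0n //.
exact: ler_norm_sum.
Qed.

Lemma avg_le_const T (F : T -> R) c :
  (0 < #|T|)%N -> (forall t, F t <= c) -> avg F <= c.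
Proof. by move=> T0 Fc; rewrite -[leRHS](avg_const c T0) ler_avg. Qed.

Lemma avg_pair T1 T2 (F : T1 * T2 -> R) :
  avg F = avg (fun a => avg (fun b => F (a, b))).
Proof.
rewrite /avg card_prod natrM invfM.
have -> : \sum_t F t = \sum_a \sum_b F (a, b).
  by rewrite pair_bigA /=; apply: eq_bigr => -[].
by rewrite -mulr_suml -mulrA [_^-1 * _]mulrC.
Qed.

(** The values of a uniformly random function are independent, so expectations of products
    factor. *)
Lemma avg_ffun_prod (I T : finType) (F : I -> T -> R) :
  avg (fun h : {ffun I -> T} => \prod_i F i (h i)) = \prod_i avg (F i).
Proof.
rewrite /avg card_ffun natrX -(bigA_distr_bigA F) big_split /=.
by rewrite prodr_const cardE -cardT exprVn.
Qed.

Lemma avg_sqr_le T (F : T -> R) : avg F ^+ 2 <= avg (fun t => F t ^+ 2).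
Proof.
have [T0|T0] := posnP #|T|.
  by rewrite /avg T0 invr0 !mulr0 expr0n.
rewrite -subr_ge0.
have <- : avg (fun t => (F t - avg F) ^+ 2)
   = avg (fun t => F t ^+ 2) - avg F ^+ 2.
  rewrite (eq_avg (F := fun t => (F t - avg F) ^+ 2)
    (G := fun t => F t ^+ 2 + (- (2 * avg F) * F t + avg F ^+ 2))).
    by rewrite !avgD avgZ avg_const //; ring.
  by move=> t; ring.
by apply: avg_ge0 => t; exact: sqr_ge0.
Qed.

(** Jensen's inequality for [|F|]. Combined with Parseval it turns bounds on Fourier weight into L1
    bounds. *)
Lemma avg_norm_le T (F : T -> R) (e : R) :
  0 <= e -> avg (fun t => F t ^+ 2) <= e ^+ 2 -> avg (fun t => `|F t|) <= e.
Proof.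
move=> e0 Fe; rewrite -(@ler_pXn2r _ 2) ?nnegrE //; last first.
  by apply: avg_ge0 => t.
apply: le_trans (avg_sqr_le _) _; apply: le_trans Fe.
by apply: ler_avg => t; rewrite -normrX ger0_norm ?sqr_ge0.
Qed.

Lemma avg_dist_norm T (F G : T -> R) (e : R) :
  avg (fun t => `|F t - G t|) <= e ->
  `|avg (fun t => `|F t|) - avg (fun t => `|G t|)| <= e.
Proof.
apply: le_trans; rewrite -avgB; apply: le_trans (ler_norm_avg _) _.
by apply: ler_avg => t; exact: ler_dist_dist.
Qed.

Lemma markov T (F : T -> R) (c d : R) : (forall t, 0 <= F t) -> 0 < c ->
  avg F <= d * c -> avg (fun t => (c < F t)%R%:R) <= d.
Proof.
move=> F0 c0 Fd; rewrite -(ler_pM2r c0); apply: le_trans Fd.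
rewrite mulrC -avgZ; apply: ler_avg => t.
by case: ltP => [/ltW|_]; rewrite ?mulr1 ?mulr0.
Qed.

Lemma avg_ffun_coord (I T : finType) (i : I) (F : T -> R) :
  (0 < #|T|)%N -> avg (fun h : {ffun I -> T} => F (h i)) = avg F.
Proof.
move=> T0; rewrite (eq_avg (G := fun h : {ffun I -> T} =>
    \prod_j (if j == i then F else fun=> 1) (h j))); last first.
  by move=> h; rewrite (bigD1 i) //= eqxx big1 ?mulr1 // => j /negPf ->.
rewrite (avg_ffun_prod (fun j => if j == i then F else fun=> 1)).
rewrite (bigD1 i) //= eqxx big1 ?mulr1 // => j /negPf ->.
by rewrite avg_const.
Qed.

Lemma avg_ffun_coord2 (I T : finType) (i j : I) (F G : T -> R) :
  (0 < #|T|)%N -> i != j ->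
  avg (fun h : {ffun I -> T} => F (h i) * G (h j)) = avg F * avg G.
Proof.
move=> T0 ij; pose H k := if k == i then F else if k == j then G else fun=> 1.
rewrite (eq_avg (G := fun h : {ffun I -> T} => \prod_k H k (h k))); last first.
  move=> h; rewrite (bigD1 i) //= (bigD1 j) 1?eq_sym //= /H eqxx.
  rewrite eq_sym (negPf ij) eqxx big1 ?mulr1 // => k.
  by case/andP=> /negPf -> /negPf ->.
rewrite (avg_ffun_prod H).
rewrite (bigD1 i) //= (bigD1 j) 1?eq_sym //= /H eqxx.
rewrite eq_sym (negPf ij) eqxx big1 ?mulr1 // => k.
by case/andP=> /negPf -> /negPf ->; rewrite avg_const.
Qed.

Lemma avg_collision (I T : finType) (i j : I) : (0 < #|T|)%N -> i != j ->
  avg (fun h : {ffun I -> T} => (h i == h j)%:R) = #|T|%:R^-1.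
Proof.
move=> T0 ij; have T1 : #|T|%:R != 0 :> R by rewrite pnatr_eq0 -lt0n.
rewrite (eq_avg (G := fun h : {ffun I -> T} =>
    \sum_a (h i == a)%:R * (h j == a)%:R)); last first.
  move=> h; rewrite (bigD1 (h i)) //= eqxx mul1r eq_sym big1 ?addr0 // => a.
  by rewrite [_ == a]eq_sym => /negPf ->; rewrite mul0r.
have E1 a : avg (fun t : T => (t == a)%:R) = #|T|%:R^-1.
  rewrite /avg (bigD1 a) //= eqxx big1 ?addr0 ?mul1r // => t.
  by move=> /negPf ->.
rewrite avg_sum (eq_bigr (fun=> #|T|%:R^-1 * #|T|%:R^-1)).
  by rewrite sumr_const -[_ * _ *+ _]mulr_natr -mulrA mulVf ?mulr1.
move=> a _.
by rewrite (avg_ffun_coord2 (fun t => (t == a)%:R) (fun t => (t == a)%:R)) // !E1.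
Qed.

End Average.

(** * Walsh-Fourier analysis and conditional expectations on the cube *)

Section Fourier.
Variables (R : realType) (n : nat).
Implicit Types (F : cube n -> R) (S T W : {set 'I_n}) (x y : cube n).
Implicit Types c : {set 'I_n} -> R.

(** The Walsh character of [T], with [true] read as -1. *)
Definition chi T x : R := \prod_i (if i \in T then (-1) ^+ (x i) else 1).
Definition fourier F T : R := avg (fun x => F x * chi T x).
Definition synth c x : R := \sum_T c T * chi T x.

Lemma card_cube_gt0 : (0 < #|{: cube n}|)%N.
Proof. by apply/card_gt0P; exists [ffun=> false]. Qed.

Lemma avg_bool (G : bool -> R) : avg G = (G true + G false) / 2.
Proof. by rewrite /avg big_bool card_bool. Qed.

Lemma avg_chiM S T : avg (fun x => chi S x * chi T x) = (S == T)%:R.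
Proof.
pose g i b : R := (if i \in S then (-1) ^+ nat_of_bool b else 1) *
                  (if i \in T then (-1) ^+ nat_of_bool b else 1).
rewrite (eq_avg (G := fun x : cube n => \prod_i g i (x i))); last first.
  by move=> x; rewrite /chi -big_split.
rewrite avg_ffun_prod; have [eST|/eqP ST] := eqVneq S T.
  rewrite big1 // => i _; rewrite avg_bool /g eST.
  by case: ifP; rewrite ?expr0 ?expr1; lra.
have [i iST] : exists i, (i \in S) != (i \in T).
  apply/existsP; apply: contra_notT ST; rewrite negb_exists => /forallP eqST.
  by apply/setP => i; have /negPn/eqP := eqST i.
rewrite (bigD1 i) //= avg_bool /g.
by case: (i \in S) (i \in T) iST => [] [] //= _; rewrite ?expr0 ?expr1; lra.
Qed.

(** The sum over [T] expands the product over [i] of 1 + (-1)^(x_i + y_i), which vanishes as soon as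
    one coordinate differs. *)
Lemma sum_chiM x y : \sum_T chi T x * chi T y = #|{: cube n}|%:R * (x == y)%:R.
Proof.
pose g i : R := (-1) ^+ (x i) * (-1) ^+ (y i).
transitivity (\prod_i (g i + 1)).
  rewrite bigA_distr; apply: eq_bigr => T _; rewrite /chi -big_split /=.
  by apply: eq_bigr => i _; case: ifP; rewrite ?mulr1.
have [exy|xy] := eqVneq x y.
  rewrite mulr1 (eq_bigr (fun=> 2)) ?prodr_const.
    by rewrite card_ffun card_bool natrX.
  by move=> i _; rewrite /g exy -expr2 sqrr_sign.
have [i xyi] : exists i, x i != y i.
  apply/existsP; apply: contraNT xy; rewrite negb_exists => /forallP eqxy.
  by apply/eqP/ffunP => i; have /negPn/eqP := eqxy i.
rewrite mulr0 (bigD1 i) //= /g.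
by case: (x i) (y i) xyi => [] [] //= _; rewrite ?expr0 ?expr1; lra.
Qed.

Lemma fourierK F x : synth (fourier F) x = F x.
Proof.
have N0 : #|{: cube n}|%:R != 0 :> R by rewrite pnatr_eq0 -lt0n card_cube_gt0.
rewrite /synth (eq_bigr (fun T => avg (fun y => F y * (chi T y * chi T x)))).
  rewrite -avg_sum (eq_avg (G := fun y => F y * (#|{: cube n}|%:R * (y == x)%:R))).
    rewrite /avg (bigD1 x) //= big1 ?addr0 ?eqxx ?mulr1 ?mulfK // => y.
    by move=> /negPf ->; rewrite !mulr0.
  by move=> y; rewrite -mulr_sumr sum_chiM.
move=> T _; rewrite mulrC -avgZ; apply: eq_avg => y; ring.
Qed.

Lemma avg_synth_sqr c : avg (fun x => synth c x ^+ 2) = \sum_T c T ^+ 2.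
Proof.
rewrite (eq_avg (G := fun x => \sum_S \sum_T c S * c T * (chi S x * chi T x))).
  rewrite avg_sum; apply: eq_bigr => S _; rewrite avg_sum (bigD1 S) //=.
  rewrite avgZ avg_chiM eqxx mulr1 big1 ?addr0 // => T TS.
  by rewrite avgZ avg_chiM eq_sym (negPf TS) mulr0.
move=> x; rewrite expr2 mulr_suml; apply: eq_bigr => S _.
rewrite mulr_sumr; apply: eq_bigr => T _; ring.
Qed.

Lemma parseval F : \sum_T fourier F T ^+ 2 = avg (fun x => F x ^+ 2).
Proof. by rewrite -avg_synth_sqr; apply: eq_avg => x; rewrite fourierK. Qed.

Definition mix W x y : cube n := [ffun i => if i \in W then x i else y i].
(** The conditional expectation E[F | x_W] as a function on the whole cube: the fresh point [y]
    replaces the coordinates outside [W]. *)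
Definition cexp W F x : R := avg (fun y => F (mix W x y)).

Lemma avg_chi_mix W T x :
  avg (fun y => chi T (mix W x y)) = (T \subset W)%:R * chi T x.
Proof.
pose g i b : R :=
  if i \in T then (-1) ^+ nat_of_bool (if i \in W then x i else b) else 1.
rewrite (eq_avg (G := fun y : cube n => \prod_i g i (y i))); last first.
  by move=> y; apply: eq_bigr => i _; rewrite /g ffunE.
rewrite avg_ffun_prod; have [TW|/subsetPn[i iT iW]] := boolP (T \subset W).
  rewrite mul1r; apply: eq_bigr => i _; rewrite avg_bool /g.
  by case: ifP => [/(subsetP TW) -> |_]; lra.
rewrite mul0r (bigD1 i) //= avg_bool /g iT (negPf iW) expr0 expr1.
lra.
Qed.

(** Averaging out the coordinates outside [W] kills exactly the characters that use one of them, so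
    conditioning is an orthogonal projection. *)
Lemma cexp_fourier W F x :
  cexp W F x = synth (fun T => (T \subset W)%:R * fourier F T) x.
Proof.
rewrite /cexp (eq_avg (G := fun y =>
    \sum_T fourier F T * chi T (mix W x y))); last first.
  by move=> y; rewrite -[LHS]fourierK.
rewrite avg_sum; apply: eq_bigr => T _; rewrite avgZ avg_chi_mix; ring.
Qed.

Lemma fourier_synth c T : fourier (synth c) T = c T.
Proof.
rewrite /fourier (eq_avg (G := fun x => \sum_S c S * (chi S x * chi T x))).
  rewrite avg_sum (bigD1 T) //= avgZ avg_chiM eqxx mulr1 big1 ?addr0 // => S ST.
  by rewrite avgZ avg_chiM (negPf ST) mulr0.
by move=> x; rewrite mulr_suml; apply: eq_bigr => S _; ring.
Qed.

Lemma cexp_cexp W W' F x : W \subset W' -> cexp W (cexp W' F) x = cexp W F x.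
Proof.
move=> WW'; rewrite !cexp_fourier; apply: eq_bigr => T _; congr (_ * _).
have [TW|_] := boolP (T \subset W); last by rewrite !mul0r.
rewrite !mul1r; have /eq_avg : (fun y => cexp W' F y * chi T y) =1
  (fun y => synth (fun S => (S \subset W')%:R * fourier F S) y * chi T y).
  by move=> y; rewrite cexp_fourier.
by rewrite /fourier => ->; rewrite -/(fourier _ _) fourier_synth
  (subset_trans TW WW') mul1r.
Qed.

Lemma avg_cexp W F : avg (cexp W F) = avg F.
Proof.
have fourier0 G : fourier G set0 = avg G.
  apply: eq_avg => x; rewrite /chi big1 ?mulr1 // => i _.
  by rewrite in_set0.
rewrite -!fourier0 /fourier.
rewrite (eq_avg (G := fun x =>
  synth (fun T => (T \subset W)%:R * fourier F T) x * chi set0 x)).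
  by rewrite -/(fourier _ _) fourier_synth sub0set mul1r.
by move=> x; rewrite cexp_fourier.
Qed.

Definition l1 F : R := avg (fun x => `|F x|).

Lemma l1_cexp W F : l1 (cexp W F) <= l1 F.
Proof.
rewrite /l1 -[leRHS](avg_cexp W); apply: ler_avg => x.
exact: ler_norm_avg.
Qed.

(** Tower property followed by Jensen: revealing more coordinates cannot lower the correlation. *)
Lemma l1_cexp_mono W W' F : W \subset W' -> l1 (cexp W F) <= l1 (cexp W' F).
Proof.
move=> WW'; rewrite /l1 (eq_avg (G := fun x => `|cexp W (cexp W' F) x|)).
  exact: l1_cexp.
by move=> x; rewrite cexp_cexp.
Qed.

End Fourier.

(** * Distance to juntas in terms of conditional expectations *)

Section JuntaDistance.
Variables (R : realType) (n : nat).
Implicit Types (f g : boolfun n) (x : cube n) (k : nat).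

Definition sgf f x : R := (-1) ^+ (f x).

Lemma sgf_norm f x : `|sgf f x| = 1.
Proof. exact: normr_sign. Qed.

Lemma dist_corr f g : dist R f g = (1 - avg (fun x => sgf f x * sgf g x)) / 2.
Proof.
have -> : dist R f g = avg (fun x => (f x != g x)%:R : R).
  rewrite /dist /avg -sum1_card natr_sum big_mkcond /=; congr (_ / _).
  by apply: eq_bigr => x _; rewrite inE; case: ifP.
rewrite -[X in X - _](avg_const 1 (card_cube_gt0 n)) -avgB mulrC -avgZ.
apply: eq_avg => x; rewrite /sgf.
by case: (f x) (g x) => [] [] /=; rewrite ?expr0 ?expr1; field.
Qed.

Definition img m k (i : {ffun 'I_k -> 'I_m}) : {set 'I_m} := [set i j | j in 'I_k].

(** When the coordinates ignored by the junta are averaged out, [sgf g] factors out with modulus 1,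
    which leaves at most E|E[f | x_S]|. *)
Lemma junta_dist_ge k f g : junta n k g ->
  exists i : {ffun 'I_k -> 'I_n}, (1 - l1 (cexp (img i) (sgf f))) / 2 <= dist R f g.
Proof.
case/existsP=> i /existsP[g0 /forallP gP]; exists i.
have gmix x y : g (mix (img i) x y) = g x.
  rewrite (eqP (gP _)) (eqP (gP x)); congr (g0 _); apply/ffunP => j.
  by rewrite !ffunE imset_f.
rewrite dist_corr ler_pM2r ?invr_gt0 // lerD2l lerN2.
rewrite -(avg_cexp (img i)); apply: le_trans (ler_norm _) _.
apply: le_trans (ler_norm_avg _) _; apply: ler_avg => x.
rewrite /cexp (eq_avg (G := fun y => sgf g x * sgf f (mix (img i) x y))).
  by rewrite avgZ normrM sgf_norm mul1r.
by move=> y; rewrite /sgf gmix mulrC.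
Qed.

(** The optimal junta takes the sign of the conditional expectation at every point. *)
Lemma junta_dist_attained k f (i : {ffun 'I_k -> 'I_n}) :
  exists2 g, junta n k g & dist R f g = (1 - l1 (cexp (img i) (sgf f))) / 2.
Proof.
pose g : boolfun n := [ffun x => cexp (img i) (sgf f) x < 0]%R.
(* Off the image of [i] the lifted point is [false]. Repeated indices carry equal values in a
   restriction of [x], so any [j] picked will do. *)
pose lift (z : cube k) : cube n :=
  [ffun c => if [pick j | i j == c] is Some j then z j else false].
have cexpE x x' : {in img i, x =1 x'} ->
    cexp (img i) (sgf f) x = cexp (img i) (sgf f) x'.
  move=> xx'; apply: eq_avg => y; congr (sgf f _); apply/ffunP => c.
  by rewrite !ffunE; case: ifP => // /xx'.
exists g.
  apply/existsP; exists i; apply/existsP; exists [ffun z => g (lift z)].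
  apply/forallP => x; rewrite !ffunE; apply/eqP; congr (_ < _)%R.
  apply: cexpE => c /imsetP[j _ ->]; rewrite ffunE.
  by case: pickP => [j' /eqP <-|/(_ j)]; rewrite ?ffunE ?eqxx.
have gmix x y : g (mix (img i) x y) = g x.
  rewrite !ffunE; congr (_ < _)%R; apply: cexpE => c cS.
  by rewrite ffunE cS.
rewrite dist_corr; congr ((1 - _) / _); rewrite -(avg_cexp (img i)).
apply: eq_avg => x.
rewrite /cexp (eq_avg (G := fun y => sgf g x * sgf f (mix (img i) x y))).
  have -> : sgf g x = (-1) ^+ (cexp (img i) (sgf f) x < 0)%R.
    by rewrite /sgf ffunE.
  rewrite avgZ -/(cexp _ _ x).
  by case: ltrP => [/ltr0_norm ->|/ger0_norm ->]; rewrite ?mulN1r ?mul1r.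
by move=> y; rewrite /sgf gmix mulrC.
Qed.

Lemma dist_le1 f g : dist R f g <= 1.
Proof.
rewrite /dist ler_pdivrMr ?ltr0n ?card_cube_gt0 // mul1r ler_nat.
exact: max_card.
Qed.

Lemma dist_class_close (C : pred (boolfun n)) f (v e : R) :
  (forall g, C g -> v - e <= dist R f g) ->
  (exists2 g, C g & dist R f g <= v + e) -> `|v - dist_class R f C| <= e.
Proof.
move=> lo [g Cg hi]; rewrite ler_distl; apply/andP; split.
  by rewrite lerBlDr; apply: le_trans hi; exact: bigmin_le_cond.
(* The default 1 of the minimum also lies above [v - e], because the class has a member and its
   distance is at most 1. *)
rewrite -lerBlDr; apply/bigmin_geP; split => //.
exact: le_trans (lo _ Cg) (dist_le1 _ _).
Qed.

End JuntaDistance.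

(** * Chernoff bounds for independent bounded samples *)

Section Concentration.
Variable R : realType.

(** The reciprocal of 1 - x <= exp (- x), where 1 / (1 - x) is below the quadratic on this range. *)
Lemma expR_le_quad (x : R) : `|x| <= 1 / 2 -> expR x <= 1 + x + 2 * x ^+ 2.
Proof.
rewrite ler_norml => /andP[x1 x2].
have e1 : 1 - x <= expR (- x) by rewrite -[1 - x]/(1 + - x) expR_ge1Dx.
have x0 : 0 < 1 - x by lra.
rewrite -[x in expR x]opprK expRN -[leLHS]mul1r ler_pdivrMr ?expR_gt0 //.
apply: le_trans (_ : (1 + x + 2 * x ^+ 2) * (1 - x) <= _); first by nra.
by rewrite ler_wpM2l //; nra.
Qed.

Lemma expR_sum_ffun (T : finType) N (Y : T -> R) (lam : R) :
  avg (fun w : {ffun 'I_N -> T} => expR (lam * \sum_a Y (w a))) =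
  avg (fun t => expR (lam * Y t)) ^+ N.
Proof.
rewrite (eq_avg (G := fun w : {ffun 'I_N -> T} =>
    \prod_a expR (lam * Y (w a)))); last first.
  by move=> w; rewrite mulr_sumr expR_sum.
rewrite (avg_ffun_prod (fun (_ : 'I_N) t => expR (lam * Y t))).
by rewrite prodr_const card_ord.
Qed.

(** Exponential Markov bound: the expectation of exp (lam * sum) factors by independence. *)
Lemma chernoff (T : finType) N (Y : T -> R) (tau : R) : (0 < #|T|)%N ->
  0 < tau <= 1 -> (forall t, `|Y t| <= 1) -> avg Y = 0 ->
  avg (fun w : {ffun 'I_N -> T} => (N%:R * tau < \sum_a Y (w a))%R%:R)
    <= expR (- (N%:R * tau ^+ 2 / 8)).
Proof.
move=> T0 /andP[tau0 tau1] Y1 EY.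
(* This minimizes the exponent 2 lam^2 - lam tau and keeps [lam * Y] in the range of
   [expR_le_quad]. *)
pose lam := tau / 4.
have -> : - (N%:R * tau ^+ 2 / 8) =
    - (lam * (N%:R * tau)) + N%:R * (2 * lam ^+ 2).
  by rewrite /lam; field.
rewrite expRD.
apply: (@le_trans _ _ (expR (- (lam * (N%:R * tau))) *
    avg (fun w : {ffun 'I_N -> T} => expR (lam * \sum_a Y (w a))))).
  rewrite -avgZ; apply: ler_avg => w; rewrite -expRD.
  case: ltP => [Nt|_]; last exact: expR_ge0.
  rewrite -[leLHS]expR0 ler_expR addrC subr_ge0 ler_pM2l ?(ltW Nt) //.
  by rewrite /lam; lra.
rewrite ler_pM2l ?expR_gt0 // expR_sum_ffun mulrC expRM_natr.
rewrite lerXn2r ?nnegrE ?expR_ge0 //; first by apply: avg_ge0 => t; exact: expR_ge0.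
apply: le_trans (expR_ge1Dx _).
apply: (@le_trans _ _ (avg (fun t => 1 + (lam * Y t + 2 * lam ^+ 2)))).
  apply: ler_avg => t; have Y1t := Y1 t.
  apply: le_trans (expR_le_quad _) _.
    rewrite normrM /lam ger0_norm; last by lra.
    have := normr_ge0 (Y t); nra.
  rewrite -addrA lerD2l lerD2l exprMn ler_pM2l // ler_piMr ?sqr_ge0 //.
  by rewrite -real_normK ?num_real // expr_le1.
by rewrite !avgD avgZ EY !avg_const // mulr0 add0r.
Qed.

Lemma avg_deviation (T : finType) N (X : T -> R) (B tau : R) :
  (0 < #|T|)%N -> 0 < tau <= 1 -> (0 < N)%N -> 0 < B ->
  (forall t, 0 <= X t <= B) ->
  avg (fun w : {ffun 'I_N -> T} =>
      (tau * B < `|avg (fun a => X (w a)) - avg X|)%R%:R)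
    <= 2 * expR (- (N%:R * tau ^+ 2 / 8)).
Proof.
move=> T0 tau01 N0 B0 XB; pose Y t := (X t - avg X) / B.
have EX : 0 <= avg X <= B.
  rewrite avg_ge0 ?avg_le_const // => t; by have /andP[] := XB t.
have Y1 t : `|Y t| <= 1.
  rewrite normrM normfV (gtr0_norm B0) ler_pdivrMr // mul1r ler_norml.
  by have := XB t; lra.
have EY : avg Y = 0.
  rewrite (eq_avg (G := fun t => B^-1 * (X t - avg X))).
    by rewrite avgZ avgB avg_const // subrr mulr0.
  by move=> t; rewrite mulrC.
have EYN : avg (fun t => - Y t) = 0 by rewrite avgN EY oppr0.
have c1 := chernoff N T0 tau01 Y1 EY.
have c2 := chernoff N (Y := fun t => - Y t) T0 tau01 _ EYN.
rewrite mulr_natl mulr2n.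
apply: le_trans (lerD c1 (c2 _)); last by move=> t; rewrite normrN.
rewrite -avgD; apply: ler_avg => w.
have NR : 0 < N%:R :> R by rewrite ltr0n.
set z := avg (fun a => X (w a)) - avg X.
have SY : \sum_a Y (w a) = N%:R / B * z.
  rewrite /z; set c := avg X; rewrite /avg card_ord -mulr_suml big_split /=.
  rewrite sumr_const card_ord -[(- c) *+ N]mulr_natr.
  by field; rewrite ?gt_eqF.
have tE (v : R) : (N%:R * tau < N%:R / B * v) = (tau * B < v).
  rewrite -[RHS](ltr_pM2l NR).
  have -> : N%:R / B * v = N%:R * v / B by field; rewrite gt_eqF.
  by rewrite ltr_pdivlMr // mulrA.
rewrite sumrN SY -[- (_ * _)]mulrN !tE lter_normr -natrD ler_nat.
by case: (tau * B < z)%R; case: (tau * B < - z)%R.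
Qed.

End Concentration.

(** * A low-degree polynomial that is 1 at 1 and small at all powers of beta *)

Section Chebyshev.

(* The pair (T_d, U_{d-1}) of Chebyshev polynomials of both kinds at [y]. *)
Fixpoint cheb (A : comNzRingType) (y : A) (d : nat) : A * A :=
  if d is d'.+1 then
    let tu := cheb y d' in
    (y * tu.1 + (y ^+ 2 - 1) * tu.2, tu.1 + y * tu.2)
  else (1, 0).

(** Pell's equation; it bounds T_d on [-1, 1] and compares it with U_{d-1} beyond 1. *)
Lemma cheb_pell (A : comNzRingType) (y : A) d :
  (cheb y d).1 ^+ 2 = 1 + (y ^+ 2 - 1) * (cheb y d).2 ^+ 2.
Proof.
elim: d => [|d IH] /=; first by ring.
move: IH; case: (cheb y d) => t u /= IH.
transitivity (t ^+ 2 - (1 + (y ^+ 2 - 1) * u ^+ 2) +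
  (1 + (y ^+ 2 - 1) * (t + y * u) ^+ 2)); first by ring.
by rewrite IH subrr add0r.
Qed.

Variable R : realType.
Implicit Types (y g : R) (p P : {poly R}).

Lemma horner_cheb p x d :
  ((cheb p d).1.[x] = (cheb p.[x] d).1) * ((cheb p d).2.[x] = (cheb p.[x] d).2).
Proof.
elim: d => [|d [IH1 IH2]] /=; first by rewrite hornerC horner0.
by rewrite !hornerE IH1 IH2.
Qed.

Lemma bernoulli (x : R) d : 0 <= x -> 1 + d%:R * x <= (1 + x) ^+ d.
Proof.
move=> x0; elim: d => [|d IH]; first by rewrite mul0r addr0 expr0.
rewrite exprS -natr1; have d0 : 0 <= d%:R :> R by [].
have : (1 + x) * (1 + d%:R * x) <= (1 + x) * (1 + x) ^+ d.
  by rewrite ler_wpM2l //; lra.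
nra.
Qed.

Lemma cheb_le1 y d : `|y| <= 1 -> `|(cheb y d).1| <= 1.
Proof.
move=> y1; rewrite -[_ <= 1](expr_le1 (n := 2)) // real_normK ?num_real //.
rewrite cheb_pell -lerBrDl subrr mulr_le0_ge0 ?sqr_ge0 // subr_le0.
by rewrite -real_normK ?num_real // expr_le1.
Qed.

(** Each step multiplies T + g U by at least y + g >= 1 + g, since y^2 - 1 >= g^2. Pell's equation
    gives g U <= T, so T is at least half of that sum. *)
Lemma cheb_growth y g d : 1 <= y -> 0 <= g -> g ^+ 2 <= y ^+ 2 - 1 ->
  (1 + g) ^+ d <= 2 * (cheb y d).1.
Proof.
move=> y1 g0 gy.
have [t0 u0 tu] : [/\ 0 <= (cheb y d).1, 0 <= (cheb y d).2 &
    (1 + g) ^+ d <= (cheb y d).1 + g * (cheb y d).2].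
  elim: d => [|d []] /=; first by rewrite expr0; split; lra.
  case: (cheb y d) => t u /= t0 u0 tu.
  have yu : g ^+ 2 * u <= (y ^+ 2 - 1) * u by rewrite ler_wpM2r.
  split.
  - by rewrite addr_ge0 ?mulr_ge0 //; nra.
  - by rewrite addr_ge0 ?mulr_ge0 //; lra.
  - have : (1 + g) * (1 + g) ^+ d <= (y + g) * (t + g * u).
      apply: ler_pM => //; rewrite ?exprn_ge0 //; lra.
    rewrite exprS; nra.
have gu : g * (cheb y d).2 <= (cheb y d).1.
  rewrite -(@ler_pXn2r _ 2) ?nnegrE ?mulr_ge0 // cheb_pell exprMn.
  by rewrite ler_wpDl // ler_wpM2r ?sqr_ge0.
lra.
Qed.

(** Coefficientwise majorization. The coefficients of [P] are then nonnegative, so [P.[1]] bounds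
    every coefficient of [p]. *)
Definition dom p P := forall i, `|p`_i| <= P`_i.

Lemma domD p P q Q : dom p P -> dom q Q -> dom (p + q) (P + Q).
Proof.
move=> pP qQ i; rewrite !coefD; exact: le_trans (ler_normD _ _) (lerD _ _).
Qed.

Lemma domM p P q Q : dom p P -> dom q Q -> dom (p * q) (P * Q).
Proof.
move=> pP qQ i; rewrite !coefM; apply: le_trans (ler_norm_sum _ _ _) _.
by apply: ler_sum => j _; rewrite normrM ler_pM.
Qed.

Lemma domC (a b : R) : `|a| <= b -> dom a%:P b%:P.
Proof. by move=> ab i; rewrite !coefC; case: ifP; rewrite ?normr0. Qed.

Lemma domX : dom 'X 'X.
Proof. by move=> i; rewrite coefX normr_nat. Qed.

Lemma dom_coef_le p P i : dom p P -> `|p`_i| <= P.[1].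
Proof.
move=> pP; apply: le_trans (pP i) _; rewrite horner_coef.
have P0 j : 0 <= P`_j by exact: le_trans (pP j).
have [iP|Pi] := ltnP i (size P); last by rewrite nth_default ?sumr_ge0 // =>
  j _; rewrite mulr_ge0 ?exprn_ge0.
rewrite (bigD1 (Ordinal iP)) //= expr1n mulr1 lerDl sumr_ge0 // => j _.
by rewrite mulr_ge0 ?exprn_ge0.
Qed.

(** Replacing [p] by 2X and the minus sign by a plus gives majorants. At 1 their recursion is (t, u)
    -> (2t + 5u, t + 2u), which costs a factor of at most 7 per step. *)
Lemma dom_cheb (p : {poly R}) d : dom p (2%:P * 'X) ->
  exists P Q, [/\ dom (cheb p d).1 P, dom (cheb p d).2 Q,
    0 <= P.[1] <= 7 ^+ d & 0 <= Q.[1] <= 7 ^+ d].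
Proof.
move=> p2; elim: d => [|d [P [Q [pP qQ P7 Q7]]]] /=.
  exists 1, 0; split; rewrite ?hornerC ?horner0 ?expr0 ?lexx ?ler01 //.
    by move=> i; rewrite !coef1 normr_nat.
  by move=> i; rewrite coef0 normr0.
exists ((2%:P * 'X) * P + ((2%:P * 'X) * (2%:P * 'X) + 1%:P) * Q).
exists (P + (2%:P * 'X) * Q); split.
- apply: domD; apply: domM => //; rewrite expr2; apply: domD.
    exact: domM.
  by rewrite -polyCN; apply: domC; rewrite normrN normr1.
- by apply: domD => //; apply: domM.
- by case/andP: P7 => ? ?; case/andP: Q7 => ? ?;
  rewrite !hornerE exprS /=; apply/andP; split; lra.
- by case/andP: P7 => ? ?; case/andP: Q7 => ? ?;
  rewrite !hornerE exprS /=; apply/andP; split; lra.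
Qed.

Lemma size_polyM_le (p q : {poly R}) a b : (size p <= a.+1)%N -> (size q <= b)%N ->
  (size (p * q)%R <= a + b)%N.
Proof.
move=> pa qb; apply: leq_trans (size_polyMleq _ _) _.
by have := leq_add pa qb; rewrite addSn; case: (_ + _)%N.
Qed.

Lemma size_cheb p d : (size p <= 2)%N ->
  (size (cheb p d).1 <= d.+1)%N && (size (cheb p d).2 <= d)%N.
Proof.
move=> p2; elim: d => [|d /andP[s1 s2]] /=.
  by rewrite size_poly1 size_poly0.
have p3 : (size (p ^+ 2 - 1)%R <= 3)%N.
  apply: leq_trans (size_polyD _ _) _.
  rewrite size_polyN size_poly1 geq_max andbT expr2.
  by rewrite (leq_trans (size_polyM_le p2 p2)).
apply/andP; split; apply: leq_trans (size_polyD _ _) _; rewrite geq_max.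
  by rewrite (size_polyM_le p2 s1) (size_polyM_le p3 s2).
by rewrite s1 (size_polyM_le p2 s2).
Qed.

(* The first [s] levels are killed by their integer roots, and the remaining
   ones lie below the spectral gap [(s + 1) / m], where Chebyshev polynomials
   are small; the roots shrink the degree from sqrt m * L to sqrt (m * L). *)
Lemma flat_poly (m s q B L : nat) (beta := 1 - m%:R^-1 : R) :
  (0 < m)%N -> (0 < q)%N -> (s.+1 <= m)%N -> (m <= q ^ 2 * s.+1)%N ->
  (2 ^ (L + 2) * m ^ s <= 2 ^ B)%N ->
  exists p : {poly R}, [/\ (size p <= (s + q * B).+1)%N, p.[1] = 1,
    forall j, (0 < j)%N -> `|p.[beta ^+ j]| <= (2 ^+ L.+1)^-1 &
    forall i, `|p`_i| <= ((2 * m) ^ s * 7 ^ (q * B))%:R].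
Proof.
move=> m0 q0 sm mq LB.
have mR0 : 0 < m%:R :> R by rewrite ltr0n.
have mR1 : 1 <= m%:R :> R by rewrite ler1n.
have im1 : m%:R^-1 <= 1 :> R by rewrite invf_le1.
have im0 : 0 < m%:R^-1 :> R by rewrite invr_gt0.
have b0 : 0 <= beta by rewrite /beta; lra.
have b1 : beta < 1 by rewrite /beta; lra.
have bj j : 0 <= beta ^+ j.+1 <= beta.
  by rewrite exprn_ge0 //= exprS ler_piMr // exprn_ile1 // ltW.
(* Root at beta^(j+1) and value 1 at 1; the normalization is at most [m] because 1 - beta^(j+1) >= 1
   - beta = 1/m. *)
pose fac j : {poly R} := ((1 - beta ^+ j.+1)^-1)%:P * ('X - (beta ^+ j.+1)%:P).
have invm j : 0 <= (1 - beta ^+ j.+1)^-1 <= m%:R.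
  have [_ bb] := andP (bj j).
  rewrite invr_ge0 subr_ge0 (le_trans bb (ltW b1)) /=.
  rewrite -[leRHS]invrK lef_pV2 ?posrE //; move: bb; rewrite /beta; lra.
pose p1 := \prod_(j < s) fac j.
(* Stretching by 1 + gam moves 1 out of the interval where Chebyshev polynomials are bounded, while
   beta^(s+1) and all higher powers stay in [0, 1]. *)
pose gam : R := s.+1%:R / m%:R.
pose Y : {poly R} := (1 + gam)%:P * 'X.
have gam0 : 0 < gam by rewrite divr_gt0 ?ltr0n.
have gam1 : gam <= 1 by rewrite ler_pdivrMr // mul1r ler_nat.
pose d := (q * B)%N.
pose M := (cheb (1 + gam) d).1.
have qR0 : 0 < q%:R :> R by rewrite ltr0n.
(* As gam >= 1/q^2, the growth rate is 1 + 1/q per degree, which doubles every [q] steps by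
   Bernoulli. *)
have Mbig : 2 ^+ B <= 2 * M.
  apply: le_trans (_ : (1 + q%:R^-1) ^+ d <= _); last first.
    apply: cheb_growth; [lra | by rewrite invr_ge0 ltW |].
    apply: (@le_trans _ _ gam); last by nra.
    rewrite exprVn -natrX -[leLHS]mul1r ler_pdivrMr ?ltr0n ?expn_gt0 ?q0 //.
    by rewrite /gam mulrAC ler_pdivlMr // mul1r -natrM ler_nat mulnC.
  rewrite /d exprM lerXn2r ?nnegrE ?exprn_ge0 //.
    by rewrite addr_ge0 ?invr_ge0 // ltW.
  apply: le_trans (bernoulli q _); last by rewrite invr_ge0 ltW.
  by rewrite mulfV ?gt_eqF.
have M0 : 0 < M.
  have : 0 < 2 ^+ B :> R by rewrite exprn_gt0.
  lra.
have M1 : 1 <= M.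
  have : 2 ^+ 1 <= 2 ^+ B :> R.
    rewrite ler_eXn2l ?ltr1n //.
    have : (2 ^ 1 <= 2 ^ B)%N.
      apply: leq_trans LB; rewrite addnC expnD -mulnA -[(2 ^ 1)%N]muln1 leq_mul //.
      by rewrite muln_gt0 !expn_gt0 m0.
    by rewrite leq_exp2l.
  rewrite expr1; lra.
exists (p1 * (M^-1 *: (cheb Y d).1)); split.
- have sp1 : (size p1 <= s.+1)%N.
    apply: leq_trans (size_prod_leq _ _) _; rewrite card_ord.
    have : (\sum_(j < s) size (fac j) <= \sum_(j < s) 2)%N.
      apply: leq_sum => j _.
      by rewrite (@size_polyM_le _ _ 0 2) ?size_polyC_leq1 ?size_XsubC.
    by rewrite sum_nat_const card_ord leq_subLR addnS ltnS addnn -muln2.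
  have sY : (size Y <= 2)%N.
    by rewrite (@size_polyM_le _ _ 0 2) ?size_polyC_leq1 ?size_polyX.
  have /andP[sT _] := size_cheb d sY.
  rewrite -addnS size_polyM_le //.
  exact: leq_trans (size_scale_leq _ _) sT.
- have Y1 : Y.[1] = 1 + gam by rewrite /Y !hornerE.
  rewrite hornerM hornerZ horner_cheb Y1 mulVf ?gt_eqF // mulr1.
  rewrite /p1 horner_prod big1 // => j _; rewrite /fac !hornerE mulVf //.
  by rewrite gt_eqF // subr_gt0; apply: le_lt_trans b1; case/andP: (bj j).
- case=> // j _; rewrite hornerM hornerZ horner_cheb.
  have [js|sj] := ltnP j s.
    rewrite /p1 horner_prod (bigD1 (Ordinal js)) //= hornerM hornerXsubC subrr.
    by rewrite mulr0 !mul0r normr0 invr_ge0 exprn_ge0.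
  have p1m : `|p1.[beta ^+ j.+1]| <= m%:R ^+ s.
    have -> : m%:R ^+ s = \prod_(i < s) m%:R :> R by rewrite prodr_const card_ord.
    rewrite /p1 horner_prod normr_prod.
    apply: ler_prod => i _; rewrite normr_ge0 /= hornerM hornerC hornerXsubC.
    rewrite normrM.
    have /andP[i0 im] := invm i; rewrite ger0_norm // -[leRHS]mulr1 ler_pM //.
    have := bj i; have := bj j; rewrite ler_norml; lra.
  have Tle : `|(cheb Y.[beta ^+ j.+1] d).1| <= 1.
    apply: cheb_le1; rewrite /Y !hornerE ger0_norm; last first.
      by rewrite mulr_ge0 ?exprn_ge0 // addr_ge0 // ltW.
    have bs : beta ^+ j.+1 <= beta ^+ s.+1.
      by rewrite ler_wiXn2l // ltW.
    (* Here 1 + gam <= (1 + 1/m)^(s+1), and (1 + 1/m) beta <= 1. *)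
    apply: (@le_trans _ _ ((1 + m%:R^-1) ^+ s.+1 * beta ^+ s.+1)).
      apply: ler_pM => //; rewrite ?exprn_ge0 //; first by lra.
      apply: le_trans (bernoulli _ _); last exact: ltW.
      by rewrite lexx.
    rewrite -exprMn exprn_ile1 // /beta; nra.
  rewrite normrM normrM normfV (gtr0_norm M0).
  (* The root factors contribute at most m^s and the Chebyshev factor 1/M, where 2M >= 2^B >=
     2^(L+2) m^s. *)
  apply: (@le_trans _ _ (m%:R ^+ s * (M^-1 * 1))).
    by rewrite ler_pM ?mulr_ge0 ?invr_ge0 ?(ltW M0) // ler_pM ?invr_ge0 ?(ltW M0).
  rewrite mulr1 ler_pdivrMr // mulrC ler_pdivlMr ?exprn_gt0 //.
  have : (2 ^ (L + 2) * m ^ s)%:R <= (2 ^ B)%:R :> R by rewrite ler_nat.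
  rewrite natrM !natrX addn2 exprS; lra.
- move=> i.
  have [P [dP P0 PM]] : exists P, [/\ dom p1 P, 0 <= P.[1] & P.[1] <= ((2 * m) ^ s)%:R].
    rewrite /p1; elim: (s) => [|s' [P [dP P0 PM]]].
      exists 1; rewrite big_ord0 hornerC expn0; split=> // l.
      by rewrite coef1 normr_nat.
    (* Each linear factor is majorized by m (X + 1), whose value at 1 is 2m. *)
    exists (P * (m%:R%:P * ('X + 1%:P))); rewrite big_ord_recr /=; split.
    + apply: domM => //; apply: domM.
        by apply: domC; have /andP[? ?] := invm s'; rewrite ger0_norm.
      apply: domD; first exact: domX.
      rewrite -polyCN; apply: domC; rewrite normrN ger0_norm.
        by case/andP: (bj s'); lra.
      by case/andP: (bj s').
    + by rewrite !(hornerM, hornerD, hornerX, hornerC) !mulr_ge0 //; lra.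
    + rewrite !(hornerM, hornerD, hornerX, hornerC) expnSr natrM.
      by rewrite ler_pM // ?natrM; lra.
  have dY : dom Y (2%:P * 'X).
    apply: domM; last exact: domX.
    by apply: domC; rewrite ger0_norm; lra.
  have [P' [_ [dP' _ /andP[P'0 P'7] _]]] := dom_cheb d dY.
  have dc : dom (M^-1 *: (cheb Y d).1) P'.
    move=> l; rewrite coefZ normrM; apply: le_trans (dP' l).
    by rewrite ler_piMl // normfV gtr0_norm // invf_le1.
  apply: le_trans (dom_coef_le i (domM dP dc)) _.
  by rewrite hornerM natrM ler_pM // natrX.
Qed.

End Chebyshev.

(** * Random hashing of the coordinates into blocks *)

Section Hashing.
Variables (R : realType) (n l k : nat).
Implicit Types (T U : {set 'I_n}) (h : {ffun 'I_n -> 'I_l.+1}) (i j c : 'I_n).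

Definition blocks h (U : {set 'I_l.+1}) : {set 'I_n} := [set c | h c \in U].

Lemma blocks_img h m (i : {ffun 'I_m -> 'I_n}) :
  img i \subset blocks h (img [ffun a => h (i a)]).
Proof.
apply/subsetP => c /imsetP[a _ ->]; rewrite inE.
by apply/imsetP; exists a; rewrite ?ffunE.
Qed.

Lemma card_img m m' (i : {ffun 'I_m -> 'I_m'}) : (#|img i| <= m)%N.
Proof. by rewrite -[leqRHS]card_ord; exact: leq_imset_card. Qed.

Variable w : {set 'I_n} -> R.
Hypotheses (w_ge0 : forall T, 0 <= w T) (w_sum : \sum_T w T <= 1).

(** With [w] the squared Fourier coefficients, this is the influence of [c] on the part of degree at
    most [k]. *)
Definition infl c : R := \sum_(T : {set 'I_n} | (c \in T) && (#|T| <= k)%N) w T.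

(** Weight of the sets that meet at most [k] blocks without being separated by [h]. Among them are
    large sets, which [infl] does not see. *)
Definition noninj h : R :=
  \sum_(T : {set 'I_n}) ((#|h @: T| <= k) && (#|h @: T| != #|T|))%N%:R * w T.

Definition collisions h : R :=
  \sum_i \sum_(j | j != i) infl i * infl j * (h i == h j)%:R.

Lemma infl_ge0 c : 0 <= infl c. Proof. exact: sumr_ge0. Qed.

Lemma sum_infl : \sum_c infl c <= k%:R.
Proof.
rewrite /infl; under eq_bigr do rewrite big_mkcond.
rewrite exchange_big /=.
apply: (@le_trans _ _ (\sum_T k%:R * w T)); last first.
  by rewrite -mulr_sumr ler_piMr.
apply: ler_sum => T _; rewrite -big_mkcond /= sumr_const -[w T *+ _]mulr_natl.
rewrite ler_wpM2r // ler_nat.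
have [Tk|_] := leqP #|T| k.
  by apply: leq_trans Tk; apply: subset_leq_card; apply/subsetP => c;
    case/andP.
by rewrite eq_card0 // => c; apply/negP => /andP[].
Qed.

Lemma card_subset T m : exists2 T' : {set 'I_n}, T' \subset T & #|T'| = minn m #|T|.
Proof.
exists [set c in take m (enum T)].
  by apply/subsetP => c; rewrite inE => /mem_take; rewrite mem_enum.
rewrite cardsE (card_uniqP _) ?take_uniq ?enum_uniq //.
by rewrite size_take_min -cardE.
Qed.

(** A subset of min(k+1, |T|) points of [T] already collides: it is [T] itself, or it has k+1 points
    and at most [k] images. The union bound then runs over at most (k+1)^2 pairs. *)
Lemma avg_noninj : avg noninj <= k.+1%:R ^+ 2 / l.+1%:R.
Proof.
rewrite /noninj avg_sum.
apply: (@le_trans _ _ (\sum_T k.+1%:R ^+ 2 / l.+1%:R * w T)); last first.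
  by rewrite -mulr_sumr ler_piMr // divr_ge0 ?exprn_ge0.
apply: ler_sum => T _.
rewrite (eq_avg (G := fun h : {ffun 'I_n -> 'I_l.+1} =>
  w T * ((#|h @: T| <= k) && (#|h @: T| != #|T|))%N%:R)); last first.
  by move=> h; rewrite mulrC.
rewrite avgZ mulrC ler_wpM2r //.
have [T' T'T cT'] := card_subset T k.+1.
apply: (@le_trans _ _ (avg (fun h : {ffun 'I_n -> 'I_l.+1} =>
  \sum_(i in T') \sum_(j in T') ((i != j) && (h i == h j))%:R))).
  apply: ler_avg => h; have sum0 :
      0 <= \sum_(i in T') \sum_(j in T') ((i != j) && (h i == h j))%:R :> R.
    by apply: sumr_ge0 => i _; apply: sumr_ge0.
  case: andP => [[hk hT]|_]; last by exact: sum0.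
  have : ~~ (#|h @: T'| == #|T'|).
    apply: contra hT => /eqP hT'; have [Tk|kT] := leqP #|T| k.
      suff <- : T' = T by rewrite hT'.
      by apply/eqP; rewrite eqEcard T'T cT' (minn_idPr (leqW Tk)) leqnn.
    have := leq_trans (subset_leq_card (imsetS h T'T)) hk.
    by rewrite hT' cT' (minn_idPl kT) ltnn.
  have [/exists_inP[i iT' /exists_inP[j jT' ij]] _|] :=
      boolP [exists i in T', exists j in T', (i != j) && (h i == h j)].
    rewrite (bigD1 i) //= (bigD1 j) //= ij -addrA lerDl addr_ge0 //.
      exact: sumr_ge0.
    by apply: sumr_ge0 => ? _; apply: sumr_ge0.
  rewrite negb_exists_in => /forall_inP inj /negP[].
  apply/imset_injP => i j iT' jT' hij; apply/eqP; apply: contraT => ij.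
  have := inj i iT'; rewrite negb_exists_in => /forall_inP/(_ j jT').
  by rewrite ij hij eqxx.
rewrite avg_sum; apply: (@le_trans _ _ (\sum_(i in T') \sum_(j in T') l.+1%:R^-1)).
  apply: ler_sum => i _; rewrite avg_sum; apply: ler_sum => j _.
  have [_|ij] /= := eqVneq i j.
    by rewrite avg_const ?invr_ge0 // card_ffun expn_gt0 card_ord.
  by rewrite (avg_collision R) ?card_ord.
have cT'k : #|T'|%:R <= k.+1%:R :> R by rewrite ler_nat cT' geq_minl.
rewrite !sumr_const -mulrnA -[_ *+ (_ * _)]mulr_natl natrM.
by rewrite ler_wpM2r ?invr_ge0 // expr2 ler_pM.
Qed.

Lemma avg_collisions : avg collisions <= k%:R ^+ 2 / l.+1%:R.
Proof.
rewrite /collisions avg_sum.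
apply: (@le_trans _ _ (\sum_i \sum_j infl i * infl j / l.+1%:R)).
  apply: ler_sum => i _; rewrite avg_sum [leRHS](bigD1 i) //=.
  rewrite ler_wpDl ?divr_ge0 ?mulr_ge0 ?infl_ge0 //; apply: ler_sum => j ji.
  by rewrite avgZ (avg_collision R) ?card_ord // eq_sym.
have -> : \sum_i \sum_j infl i * infl j / l.+1%:R =
    (\sum_i infl i) ^+ 2 / l.+1%:R.
  rewrite expr2 mulr_suml mulr_suml; apply: eq_bigr => i _.
  by rewrite mulr_sumr mulr_suml.
rewrite ler_wpM2r ?invr_ge0 // lerXn2r ?nnegrE ?sum_infl //.
by apply: sumr_ge0 => c _; exact: infl_ge0.
Qed.

(* In every block only the most influential coordinate matters: the influence
   [b] of the others satisfies [b ^+ 2 <= collisions h]. *)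
Lemma transversal h (u : {ffun 'I_k -> 'I_l.+1}) (eta : R) :
  (0 < n)%N || (k == 0)%N -> 0 <= eta -> collisions h <= eta ^+ 2 ->
  exists i : {ffun 'I_k -> 'I_n},
    \sum_(T : {set 'I_n} | (T \subset blocks h (img u)) && ~~ (T \subset img i)) w T
    <= noninj h + k%:R * eta.
Proof.
move=> nk eta0 coll.
(* The most influential coordinate of each block; an empty block gets an arbitrary one. *)
have [i iP] : exists i : 'I_k -> 'I_n, forall a c, h c == u a ->
    (h (i a) == u a) && (infl c <= infl (i a)).
  apply: (@fin_all_exists _ (fun=> 'I_n) (fun a ia => forall c, h c == u a ->
    (h ia == u a) && (infl c <= infl ia))) => a.
  have n0 : (0 < n)%N.
    by case/orP: nk => // /eqP k0; move: a; rewrite k0 => -[].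
  have [/existsP[c0 hc0]|] := boolP [exists c, h c == u a].
    case: (@arg_maxP _ _ _ c0 (fun c => h c == u a) infl hc0) => c hc cmax.
    by exists c => c' hc'; rewrite hc; exact: cmax.
  rewrite negb_exists => /forallP none; exists (Ordinal n0) => c hc.
  by have := none c; rewrite hc.
pose b a := \sum_(c | (h c == u a) && (c != i a)) infl c.
have b_le a : b a <= eta.
  rewrite -(@ler_pXn2r _ 2) ?nnegrE ?sumr_ge0 // => [|c _]; last exact: infl_ge0.
  apply: le_trans coll; rewrite expr2 {1}/b mulr_suml /collisions.
  rewrite big_mkcond; apply: ler_sum => c _.
  have nn c1 c2 : 0 <= infl c1 * infl c2 * (h c1 == h c2)%:R.
    by rewrite !mulr_ge0 ?infl_ge0.
  case: ifP => [/andP[hc ci]|_]; last exact: sumr_ge0.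
  have /andP[hi cle] := iP a c hc.
  rewrite (eq_bigr (fun c' => infl c * (infl c' * (h c' == h c)%:R))); last first.
    by move=> c' _; rewrite mulrA [h c == _]eq_sym.
  rewrite -mulr_sumr ler_wpM2l ?infl_ge0 //.
  (* The diagonal term [infl c] is missing from [collisions]. The term of [i a], absent from [b a]
     and at least as large, pays for it. *)
  rewrite /b (bigD1 c) /= ?hc // [leRHS](bigD1 (i a)) /= 1?eq_sym //.
  rewrite (eqP hi) (eqP hc) eqxx mulr1 lerD //.
  rewrite big_mkcond [leRHS]big_mkcond; apply: ler_sum => c' _.
  case: (h c' == u a); case: (c' != i a); case: (c' != c) => //=;
    by rewrite ?mulr1 ?mulr0 ?infl_ge0.
exists [ffun a => i a].
apply: (@le_trans _ _ (noninj h + \sum_a b a)); last first.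
  rewrite lerD2l -[k in k%:R]card_ord mulr_natl -sumr_const.
  exact: ler_sum.
have -> : \sum_a b a = \sum_(T : {set 'I_n})
    (\sum_a \sum_(c | (h c == u a) && (c != i a)) ((c \in T) && (#|T| <= k)%N)%:R) * w T.
  under [RHS]eq_bigr do rewrite mulr_suml.
  rewrite exchange_big; apply: eq_bigr => a _.
  under [RHS]eq_bigr do rewrite mulr_suml.
  rewrite exchange_big; apply: eq_bigr => c _.
  rewrite /infl big_mkcond; apply: eq_bigr => T _.
  by case: ifP; rewrite ?mul1r ?mul0r.
rewrite big_mkcond -big_split /=; apply: ler_sum => T _; rewrite -mulrDl.
have sum_nn : 0 <= \sum_a \sum_(c | (h c == u a) && (c != i a))
    ((c \in T) && (#|T| <= k)%N)%:R :> R.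
  by apply: sumr_ge0 => a _; apply: sumr_ge0.
(* Such a [T] meets at most [k] blocks. Either [h] is not injective on it and [noninj] counts it, or
   |T| <= k and it is counted in the influence of its coordinate [c] outside [img i]. *)
case: ifP => [/andP[TU /subsetPn[c cT ci]]|_]; last first.
  by rewrite mulr_ge0 ?addr_ge0.
rewrite ler_peMl //.
have hTU : h @: T \subset img u.
  by apply/subsetP => _ /imsetP[c' c'T ->]; have := subsetP TU _ c'T; rewrite inE.
have hTk := leq_trans (subset_leq_card hTU) (card_img u); rewrite hTk /=.
have [hT|_] := eqVneq #|h @: T| #|T|; last by rewrite lerDl.
rewrite add0r.
have : c \in blocks h (img u) by apply: (subsetP TU).
rewrite inE => /imsetP[a _ hc].
have cia : c != i a.
  by apply: contraNneq ci => ->; apply/imsetP; exists a; rewrite ?ffunE.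
rewrite (bigD1 a) //= (bigD1 c) /= ?hc ?eqxx ?cia // cT -hT hTk /= -addrA lerDl.
by rewrite addr_ge0 ?sumr_ge0 // => a' _; apply: sumr_ge0.
Qed.

End Hashing.

(** By Markov, [noninj] and [collisions] are each too large with probability at most 1/12. Otherwise
    [transversal] bounds the Fourier weight lost on passing from a union to one coordinate per block
    by e^2. The constant 48 = 12 * 4 comes from the bound on [collisions]. *)
Lemma hashing_good (R : realType) (n l k : nat) (F : cube n -> R) (e : R) :
  (0 < n)%N || (k == 0)%N -> avg (fun x => F x ^+ 2) <= 1 -> 0 < e <= 1 ->
  48 * k.+1%:R ^+ 4 <= l.+1%:R * e ^+ 4 ->
  avg (fun h : {ffun 'I_n -> 'I_l.+1} => (~~ [forall u : {ffun 'I_k -> 'I_l.+1},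
     exists i : {ffun 'I_k -> 'I_n},
       l1 (cexp (blocks h (img u)) F) <= l1 (cexp (img i) F) + e])%:R) <= 1 / 6 :> R.
Proof.
move=> nk F1 /andP[e0 e1] le.
pose w T := fourier F T ^+ 2.
have w0 T : 0 <= w T by exact: sqr_ge0.
have w1 : \sum_T w T <= 1 by rewrite parseval.
(* Chosen so that k eta <= e^2 / 2, the other half being left to [noninj]. *)
pose eta := e ^+ 2 / 2 / k.+1%:R.
have k0 : 0 < k.+1%:R :> R by rewrite ltr0n.
have k1 : 1 <= k.+1%:R :> R by rewrite ler1n.
have l0 : 0 < l.+1%:R :> R by rewrite ltr0n.
have e2 : 0 < e ^+ 2 by rewrite exprn_gt0.
have e21 : e ^+ 2 <= 1 by rewrite exprn_ile1 // ltW.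
have eta0 : 0 < eta by rewrite !divr_gt0.
have ni_ge0 (h : {ffun 'I_n -> 'I_l.+1}) : 0 <= noninj k w h.
  by apply: sumr_ge0 => T _; rewrite mulr_ge0.
have co_ge0 (h : {ffun 'I_n -> 'I_l.+1}) : 0 <= collisions k w h.
  by apply: sumr_ge0 => i _; apply: sumr_ge0 => j _; rewrite !mulr_ge0 ?infl_ge0.
have A1 : avg (fun h : {ffun 'I_n -> 'I_l.+1} =>
    (e ^+ 2 / 2 < noninj k w h)%R%:R) <= 1 / 12 :> R.
  apply: markov => //; first by rewrite divr_gt0.
  apply: le_trans (avg_noninj _ _ w0 w1) _.
  rewrite ler_pdivrMr //.
  have k24 : k.+1%:R ^+ 2 <= k.+1%:R ^+ 4 :> R by rewrite ler_weXn2l.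
  have : l.+1%:R * e ^+ 4 <= l.+1%:R * e ^+ 2.
    by rewrite ler_wpM2l // ler_wiXn2l // ltW.
  have : 0 <= k.+1%:R ^+ 2 :> R by rewrite exprn_ge0.
  move: le k24; set a := e ^+ 2; set a2 := e ^+ 4; lra.
have A2 : avg (fun h : {ffun 'I_n -> 'I_l.+1} =>
    (eta ^+ 2 < collisions k w h)%R%:R) <= 1 / 12 :> R.
  apply: markov => //; first by rewrite exprn_gt0.
  apply: le_trans (avg_collisions _ _ w0 w1) _.
  rewrite ler_pdivrMr //.
  have -> : eta ^+ 2 = e ^+ 4 / 4 / k.+1%:R ^+ 2.
    by rewrite /eta !expr_div_n -exprM -[2 ^+ 2]natrX.
  rewrite mulrAC mulrA ler_pdivlMr ?exprn_gt0 //.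
  have k2 : k%:R ^+ 2 <= k.+1%:R ^+ 2 :> R.
    by rewrite lerXn2r ?nnegrE // ler_nat.
  have : k%:R ^+ 2 * k.+1%:R ^+ 2 <= k.+1%:R ^+ 2 * k.+1%:R ^+ 2 :> R.
    by rewrite ler_wpM2r ?exprn_ge0.
  have : 0 <= k.+1%:R ^+ 4 :> R by rewrite exprn_ge0.
  rewrite -[k.+1%:R ^+ 2 * _]exprD; move: le; set a2 := e ^+ 4; lra.
apply: le_trans (_ : 1 / 12 + 1 / 12 <= _); last by lra.
apply: le_trans (lerD A1 A2); rewrite -avgD; apply: ler_avg => h.
have [ni|ni] := ltP (e ^+ 2 / 2) (noninj k w h).
  by rewrite -natrD ler_nat; apply: leq_trans (leq_b1 _) _.
have [co|co] := ltP (eta ^+ 2) (collisions k w h).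
  by rewrite -natrD ler_nat; apply: leq_trans (leq_b1 _) _.
suff -> : [forall u : {ffun 'I_k -> 'I_l.+1}, exists i : {ffun 'I_k -> 'I_n},
    l1 (cexp (blocks h (img u)) F) <= l1 (cexp (img i) F) + e].
  by rewrite addr_ge0.
apply/forallP => u.
have [i iw] := transversal w0 u nk (ltW eta0) co.
apply/existsP; exists i.
set W := blocks h (img u).
(* After intersecting with [W] the sets are nested, and the two expectations differ exactly by the
   characters inside [W] but not inside [img i]. *)
apply: (@le_trans _ _ (l1 (cexp (W :&: img i) F) + e)); last first.
  by rewrite lerD2r l1_cexp_mono // subsetIr.
rewrite -lerBlDl; apply: le_trans (ler_norm _) _; apply: avg_dist_norm.
apply: avg_norm_le; first exact: ltW.
pose c (T : {set 'I_n}) := ((T \subset W)%:R - (T \subset W :&: img i)%:R) * fourier F T.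
rewrite (eq_avg (G := fun x => synth c x ^+ 2)); last first.
  move=> x; rewrite !cexp_fourier /synth -sumrB; congr (_ ^+ 2).
  by apply: eq_bigr => T _; rewrite /c !mulrBl.
rewrite avg_synth_sqr.
have -> : \sum_T c T ^+ 2 =
    \sum_(T : {set 'I_n} | (T \subset W) && ~~ (T \subset img i)) w T.
  rewrite [RHS]big_mkcond; apply: eq_bigr => T _; rewrite /c subsetI.
  by case: (T \subset W); case: (T \subset img i) => /=;
    rewrite ?subrr ?subr0 ?mul0r ?mul1r ?expr0n.
apply: le_trans iw _.
have : k%:R * eta <= e ^+ 2 / 2.
  rewrite /eta mulrCA ler_piMr ?divr_ge0 ?(ltW e2) // ler_pdivrMr // mul1r.
  by rewrite ler_nat.
lra.
Qed.

(** * Mean error of an empirical average *)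

Section SampleMean.
Variable R : realType.

(** A variance computation: the cross terms vanish by independence, leaving at most B^2 / N <=
    e^2. *)
Lemma avg_sample_mean (T : finType) N (Z : T -> R) (B e : R) :
  (0 < #|T|)%N -> (0 < N)%N -> (forall t, `|Z t| <= B) -> 0 <= e ->
  B ^+ 2 <= e ^+ 2 * N%:R ->
  avg (fun w : {ffun 'I_N -> T} => `|avg (fun b => Z (w b)) - avg Z|) <= e.
Proof.
move=> T0 N0 ZB e0 BN; apply: avg_norm_le => //.
have NR : 0 < N%:R :> R by rewrite ltr0n.
pose Y t := Z t - avg Z.
have EY : avg Y = 0 by rewrite avgB avg_const // subrr.
have EY2 : avg (fun t => Y t ^+ 2) <= B ^+ 2.
  apply: (@le_trans _ _ (avg (fun t => Z t ^+ 2))).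
    rewrite (eq_avg (G := fun t => Z t ^+ 2 + (- (2 * avg Z) * Z t + avg Z ^+ 2))).
      by rewrite !avgD avgZ avg_const // gerDl; have := sqr_ge0 (avg Z); nra.
    by move=> t; rewrite /Y; ring.
  apply: avg_le_const => // t; rewrite -real_normK ?num_real //.
  by rewrite lerXn2r ?nnegrE ?ZB //; apply: le_trans (ZB t).
rewrite (eq_avg (G := fun w : {ffun 'I_N -> T} =>
    N%:R ^- 2 * \sum_a \sum_b Y (w a) * Y (w b))); last first.
  move=> w; have -> : avg (fun b => Z (w b)) - avg Z = N%:R^-1 * \sum_b Y (w b).
    rewrite /Y; set c := avg Z; rewrite /avg card_ord big_split /=.
    rewrite sumr_const card_ord -[(- c) *+ N]mulr_natr.
    by field; rewrite gt_eqF.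
  rewrite exprMn exprVn; congr (_ * _); rewrite expr2 mulr_suml.
  by apply: eq_bigr => a _; rewrite mulr_sumr.
rewrite avgZ avg_sum (eq_bigr (fun=> avg (fun t => Y t ^+ 2))); last first.
  move=> a _; rewrite avg_sum (bigD1 a) //= big1 => [|b ba].
    by rewrite addr0 (avg_ffun_coord a (fun t => Y t * Y t)).
  by rewrite (avg_ffun_coord2 Y Y) 1?eq_sym // EY mulr0.
rewrite sumr_const card_ord -[avg _ *+ N]mulr_natr.
rewrite mulrC ler_pdivrMr ?exprn_gt0 // [N%:R ^+ 2]expr2 mulrA ler_pM2r //.
exact: le_trans EY2 BN.
Qed.

End SampleMean.

(** * Estimating conditional expectations from noisy copies of a point *)

Section LocalEstimator.
Variables (R : realType) (n l D m : nat).
Variables (p : {poly R}) (h : {ffun 'I_n -> 'I_l.+1}) (F : cube n -> R).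
Implicit Types (x : cube n) (U : {set 'I_l.+1}) (T : {set 'I_n}).

Let beta : R := 1 - m.+1%:R^-1.

(* [r] holds [D] independent dice per block; a block survives [i] rounds of
   noise when its first [i] dice avoid 0, so the noise rates [beta ^+ i] are
   realized by a uniform seed. *)
Definition kept (i : nat) (r : {ffun 'I_D -> 'I_m.+1}) : bool :=
  [forall j : 'I_D, (j < i)%N ==> (r j != ord0)].

Notation dice := {ffun 'I_l.+1 -> {ffun 'I_D -> 'I_m.+1}}.

Definition survivors (i : nat) (v : dice) : {set 'I_l.+1} :=
  [set b | kept i (v b)].

(** The seed of one query: number of rounds, dice, and the fresh point that overwrites the blocks
    that die. *)
Definition noise := ('I_D.+1 * (dice * cube n))%type.

Definition point x (w : noise) : cube n :=
  mix (blocks h (survivors w.1 w.2.1)) x w.2.2.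

(** Importance weighting: [D.+1] undoes the uniform choice of the exponent, and the negative power
    of beta undoes the probability that [U] survives. *)
Definition estim U x (w : noise) : R :=
  D.+1%:R * p`_w.1 * beta ^- (w.1 * #|U|) *
  ((U \subset survivors w.1 w.2.1)%:R * F (point x w)).

Lemma avg_kept i : (i <= D)%N -> avg (fun r => (kept i r)%:R) = beta ^+ i.
Proof.
move=> iD; pose g (j : 'I_D) (t : 'I_m.+1) : R :=
  if (j < i)%N then (t != ord0)%:R else 1.
rewrite (eq_avg (G := fun r : {ffun 'I_D -> 'I_m.+1} => \prod_j g j (r j))).
  rewrite avg_ffun_prod.
  have -> : beta ^+ i = \prod_(j < D) (if (j < i)%N then beta else 1).
    rewrite -big_mkcond /= -(big_ord_widen D (fun=> beta) iD).
    by rewrite prodr_const card_ord.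
  apply: eq_bigr => j _; rewrite /g; case: ifP => _; last first.
    by rewrite avg_const // card_ord.
  rewrite (eq_avg (G := fun t : 'I_m.+1 => 1 - (t == ord0)%:R)); last first.
    by move=> t; case: eqP => _; rewrite ?subrr ?subr0.
  rewrite avgB avg_const ?card_ord // /avg (bigD1 ord0) //= ?eqxx big1.
    by rewrite addr0 mul1r card_ord.
  by move=> t /negPf ->.
move=> r; have [/forallP rP|] := boolP (kept i r).
  by rewrite big1 // => j _; rewrite /g; case: ifP => // ji; rewrite (implyP (rP j) ji).
rewrite /kept negb_forall => /existsP[j]; rewrite negb_imply negbK => /andP[ji rj].
by rewrite (bigD1 j) //= /g ji rj mul0r.
Qed.

Lemma avg_survivors i U : (i <= D)%N ->
  avg (fun v => (U \subset survivors i v)%:R) = beta ^+ (i * #|U|).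
Proof.
move=> iD; pose g (b : 'I_l.+1) (r : {ffun 'I_D -> 'I_m.+1}) : R :=
  if b \in U then (kept i r)%:R else 1.
rewrite (eq_avg (G := fun v : dice => \prod_b g b (v b))).
  rewrite avg_ffun_prod exprM -prodr_const [RHS]big_mkcond.
  apply: eq_bigr => b _; rewrite /g; case: ifP => _; first exact: avg_kept.
  by rewrite avg_const // card_ffun card_ord expn_gt0.
move=> v; have [/subsetP Uv|/subsetPn[b bU bv]] := boolP (_ \subset _).
  by rewrite big1 // => b _; rewrite /g; case: ifP => // /Uv; rewrite inE => ->.
by rewrite (bigD1 b) //= /g bU; move: bv; rewrite inE => /negPf ->; rewrite mul0r.
Qed.

Lemma blocks_sub T U : (T \subset blocks h U) = (h @: T \subset U).
Proof.
apply/subsetP/subsetP => [TU _ /imsetP[c cT ->]|hTU c cT].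
  by have := TU c cT; rewrite inE.
by rewrite inE hTU // imset_f.
Qed.

Lemma cardsUDr (T : finType) (A B : {set T}) :
  #|A :|: B| = (#|A| + #|B :\: A|)%N.
Proof.
by rewrite cardsU cardsD [A :&: B]setIC addnBA // subset_leq_card // subsetIl.
Qed.

(** For a fixed exponent i, the character of [T] counts when [U] and all blocks met by [T] survive,
    with probability beta^(i |U :|: h(T)|). Reweighting leaves beta^(i |h(T) minus U|), and summing
    over i against the coefficients evaluates [p]. *)
Lemma avg_estim U x : (0 < m)%N -> (size p <= D.+1)%N ->
  avg (estim U x) =
  synth (fun T => p.[beta ^+ #|h @: T :\: U|] * fourier F T) x.
Proof.
move=> m0 sp.
have b0 : beta != 0.
  by rewrite /beta subr_eq0 eq_sym invr_eq1 pnatr_eq1 eqSS -lt0n.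
rewrite avg_pair.
rewrite (eq_avg (G := fun i : 'I_D.+1 => D.+1%:R *
    \sum_(T : {set 'I_n}) p`_i * (beta ^+ #|h @: T :\: U|) ^+ i *
      (fourier F T * chi R T x))).
  rewrite avgZ avg_sum mulr_sumr; apply: eq_bigr => T _.
  rewrite /avg mulrCA card_ord mulfV ?pnatr_eq0 // mulr1 -mulr_suml.
  by rewrite -(horner_coef_wide _ sp) mulrA.
move=> i; rewrite avg_pair.
rewrite (eq_avg (G := fun v : dice => D.+1%:R * p`_i * beta ^- (i * #|U|) *
  \sum_(T : {set 'I_n}) (fourier F T * chi R T x) *
    (U :|: h @: T \subset survivors i v)%:R)).
  rewrite avgZ avg_sum -!mulrA; congr (_ * _).
  rewrite !mulr_sumr; apply: eq_bigr => T _.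
  have iD : (i <= D)%N by rewrite -ltnS.
  rewrite avgZ (avg_survivors _ iD) cardsUDr mulnDr exprD.
  rewrite -[(_ ^+ _) ^+ i]exprM [(_ * i)%N]mulnC.
  have : beta ^+ (i * #|U|) != 0 by rewrite expf_neq0.
  by move: (beta ^+ (i * #|U|)) => a a0; field.
move=> v; rewrite /estim /= avgZ avgZ; congr (_ * _).
rewrite -[avg _]/(cexp (blocks h (survivors i v)) F x).
rewrite cexp_fourier /synth mulr_sumr; apply: eq_bigr => T _.
rewrite blocks_sub subUset.
by case: (_ \subset _); case: (_ \subset _); rewrite ?mul1r ?mul0r ?mulr1 ?mulr0.
Qed.

(** The only exponential weight besides the coefficients is beta^(-i |U|), at most 2^i <= 2^D when
    beta^|U| >= 1/2. *)
Lemma estim_le U x w (G : R) :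
  (forall i, `|p`_i| <= G) -> (forall y, `|F y| <= 1) -> 1 / 2 <= beta ^+ #|U| ->
  `|estim U x w| <= D.+1%:R * G * 2 ^+ D.
Proof.
move=> pG F1 bU.
have bU0 : 0 < beta ^+ #|U| by lra.
have bV : `|beta ^- (w.1 * #|U|)| <= 2 ^+ D.
  rewrite normfV mulnC exprM normrX gtr0_norm // -exprVn.
  apply: (@le_trans _ _ (2 ^+ w.1)).
    rewrite lerXn2r ?nnegrE ?invr_ge0 ?(ltW bU0) //.
    by rewrite -[leRHS]invrK lef_pV2 ?posrE ?invr_gt0 //; lra.
  by rewrite ler_weXn2l ?ler1n // -ltnS.
rewrite /estim normrM -[leRHS]mulr1; apply: ler_pM => //.
  rewrite !normrM normr_nat; apply: ler_pM => //; first by rewrite mulr_ge0.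
  by rewrite ler_wpM2l.
by rewrite normrM; case: (_ \subset _); rewrite ?normr1 ?normr0 ?mul1r ?mul0r.
Qed.

(** The multiplier is exactly 1 on the characters inside the blocks of [U] and at most [e] on the
    others, so Parseval bounds the L2 error by [e]. *)
Lemma estim_flat U (e : R) : (0 < m)%N -> (size p <= D.+1)%N -> p.[1] = 1 ->
  (forall j, (0 < j)%N -> `|p.[beta ^+ j]| <= e) -> 0 <= e ->
  avg (fun x => F x ^+ 2) <= 1 ->
  `|l1 (fun x => avg (estim U x)) - l1 (cexp (blocks h U) F)| <= e.
Proof.
move=> m0 sp p1 pe e0 F1; apply: avg_dist_norm; apply: avg_norm_le => //.
pose c (T : {set 'I_n}) :=
  (p.[beta ^+ #|h @: T :\: U|] - (T \subset blocks h U)%:R) * fourier F T.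
rewrite (eq_avg (G := fun x => synth c x ^+ 2)); last first.
  move=> x; rewrite avg_estim // cexp_fourier /synth -sumrB; congr (_ ^+ 2).
  by apply: eq_bigr => T _; rewrite /c !mulrBl.
rewrite avg_synth_sqr; apply: (@le_trans _ _ (\sum_T e ^+ 2 * fourier F T ^+ 2)).
  apply: ler_sum => T _; rewrite /c exprMn ler_wpM2r ?sqr_ge0 //.
  rewrite blocks_sub -setD_eq0 -cards_eq0.
  have [->|hTU] := eqVneq #|h @: T :\: U| 0%N.
    by rewrite expr0 p1 subrr expr0n /= sqr_ge0.
  rewrite subr0 -real_normK ?num_real // lerXn2r ?nnegrE //.
  by rewrite pe // lt0n.
by rewrite -mulr_sumr parseval ler_piMr ?sqr_ge0.
Qed.

End LocalEstimator.

Lemma bernoulli_sub (R : realType) (x : R) d : 0 <= x <= 1 ->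
  1 - d%:R * x <= (1 - x) ^+ d.
Proof.
move=> /andP[x0 x1]; elim: d => [|d IH]; first by rewrite mul0r subr0 expr0.
rewrite exprS -natr1; have d0 : 0 <= d%:R :> R by [].
have : (1 - x) * (1 - d%:R * x) <= (1 - x) * (1 - x) ^+ d.
  by rewrite ler_wpM2l //; lra.
nra.
Qed.

(** * Non-adaptive query trees *)

Section QueryTree.
Variables (A : Type) (n : nat).
Implicit Types (f g : boolfun n) (Phi : boolfun n -> A) (s : seq (cube n)).

Definition upd g (x : cube n) (b : bool) : boolfun n :=
  [ffun y => if y == x then b else g y].

(** The argument [g] records the answers, so that a leaf can evaluate [Phi] without access to the
    function. *)
Fixpoint ask s g Phi : query_tree A n :=
  if s is x :: s' then
    Query x (ask s' (upd g x true) Phi) (ask s' (upd g x false) Phi)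
  else Output n (Phi g).

Lemma queried_ask s g Phi f : queried (ask s g Phi) f = s.
Proof. by elim: s g => //= x s IH g; case: ifP; rewrite IH. Qed.

(** The record at the leaf agrees with [f] on [s], as a repeated query is overwritten by the same
    answer, and [Phi] looks at no other point. *)
Lemma run_ask s g Phi f :
  (forall f', {in s, f' =1 f} -> Phi f' = Phi f) -> run (ask s g Phi) f = Phi f.
Proof.
suff [f' [sf' _ ->]] : exists f', [/\ {in s, f' =1 f},
    forall y, y \notin s -> f' y = g y & run (ask s g Phi) f = Phi f'].
  exact.
elim: s g => [|x s IH] g /=; first by exists g.
have [f' [sf' gf' runE]] := IH (upd g x (f x)).
exists f'; split; last by rewrite -runE; case: (f x).
  move=> y; rewrite inE; have [ys _|ys] := boolP (y \in s); first exact: sf'.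
  by rewrite orbF => /eqP yx; rewrite gf' // ffunE yx eqxx.
by move=> y; rewrite inE negb_or => /andP[/negPf yx ys]; rewrite gf' // ffunE yx.
Qed.

End QueryTree.

(** * The estimator and its correctness *)

Section Estimator.
Variables (R : realType) (n l k D m N1 N2 : nat) (p : {poly R}).
Implicit Types (f : boolfun n) (h : {ffun 'I_n -> 'I_l.+1}).

Notation sample := (cube n * {ffun 'I_N1 -> noise n l D m})%type.
Notation samples := {ffun 'I_N2 -> sample}.

(** The inner average approximates the mean of [estim] at one point before the absolute value is
    taken. The same queries serve every [U]. *)
Definition corr_est h f (U : {set 'I_l.+1}) (s : samples) : R :=
  avg (fun a => `|avg (fun b => estim p h (sgf R f) U (s a).1 ((s a).2 b))|).

Definition query_points h (s : samples) : seq (cube n) :=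
  [seq point h (s ab.1).1 ((s ab.1).2 ab.2) | ab : 'I_N2 * 'I_N1].

Definition max_corr h (s : samples) f : R :=
  \big[Num.max/0]_(u : {ffun 'I_k -> 'I_l.+1}) corr_est h f (img u) s.

Notation tree_seed := ({ffun 'I_n -> 'I_l.+1} * samples)%type.

Lemma card_noise_gt0 : (0 < #|{: noise n l D m}|)%N.
Proof.
by apply/card_gt0P; exists (ord0, ([ffun=> [ffun=> ord0]], [ffun=> false])).
Qed.

Lemma card_seed_gt0 : (0 < #|{: tree_seed}|)%N.
Proof.
apply/card_gt0P; exists ([ffun=> ord0], [ffun=> ([ffun=> false],
  [ffun=> (ord0, ([ffun=> [ffun=> ord0]], [ffun=> false]))])]).
by [].
Qed.

(* The class of juntas is empty exactly when n = 0 < k. *)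
Definition estimator_tree (w : tree_seed) : query_tree R n :=
  if (0 < n)%N || (k == 0)%N then
    ask (query_points w.1 w.2) [ffun=> false]
        (fun f => (1 - max_corr w.1 w.2 f) / 2)
  else Output n 1.

Lemma estimator_weight_ge0 (w : tree_seed) : 0 <= (#|{: tree_seed}|%:R^-1 : R).
Proof. by rewrite invr_ge0. Qed.

Lemma estimator_weight_sum : \sum_(w : tree_seed) (#|{: tree_seed}|%:R^-1 : R) = 1.
Proof.
rewrite sumr_const -[_ *+ _]mulr_natl mulfV // pnatr_eq0 -lt0n.
exact: card_seed_gt0.
Qed.

Definition estimator : rand_algo R n :=
  @RandAlgo R n {: tree_seed} (fun=> #|{: tree_seed}|%:R^-1)
    estimator_weight_ge0 estimator_weight_sum estimator_tree.

Lemma estimator_queries w f :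
  (size (queried (estimator_tree w) f) <= N2 * N1)%N.
Proof.
rewrite /estimator_tree; case: ifP => // _.
by rewrite queried_ask size_map -cardE card_prod !card_ord.
Qed.

Lemma estimator_nonadaptive : nonadaptive estimator.
Proof.
move=> w f g; rewrite /= /estimator_tree; case: ifP => // _.
by rewrite !queried_ask.
Qed.

Lemma run_estimator w f : (0 < n)%N || (k == 0)%N ->
  run (estimator_tree w) f = (1 - max_corr w.1 w.2 f) / 2.
Proof.
rewrite /estimator_tree => ->; apply: run_ask => f' ff'.
congr ((1 - _) / _); apply: eq_bigr => u _.
apply: eq_avg => a; congr `|_|; apply: eq_avg => b.
rewrite /estim /sgf ff' //; apply/mapP; exists (a, b) => //.
by rewrite mem_enum.
Qed.

Lemma prob_estimator (E : pred tree_seed) :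
  @prob R n estimator E = avg (fun w => (E w)%:R).
Proof.
rewrite /prob /avg mulr_suml big_mkcond; apply: eq_bigr => w _ /=.
by case: (E w); rewrite ?mul1r ?mul0r.
Qed.

(** For the union bound: exp (l+1) >= l+1 absorbs each of the [k] choices of a block, and exp 40 >=
    41 supplies the constant. *)
Lemma expR_union (x : R) : k%:R * l.+1%:R + 40 <= x ->
  #|{ffun 'I_k -> 'I_l.+1}|%:R * (2 * expR (- x)) <= 1 / 6.
Proof.
move=> kx; rewrite expRN card_ffun !card_ord natrX mulrCA mulrA.
rewrite ler_pdivrMr ?expR_gt0 //.
have lx : l.+1%:R ^+ k * 41 <= expR x.
  apply: (@le_trans _ _ (expR (k%:R * l.+1%:R + 40))); last by rewrite ler_expR.
  rewrite expRD [k%:R * _]mulrC expRM_natr ler_pM ?exprn_ge0 //.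
    rewrite lerXn2r ?nnegrE ?expR_ge0 //; apply: le_trans (expR_ge1Dx _); lra.
  by apply: le_trans (expR_ge1Dx _); lra.
have : 0 <= l.+1%:R ^+ k :> R by rewrite exprn_ge0.
lra.
Qed.

Hypotheses (m_gt0 : (0 < m)%N) (km : (k.*2 <= m.+1)%N).
Hypotheses (N1_gt0 : (0 < N1)%N) (N2_gt0 : (0 < N2)%N).
Variables (G e : R).
Hypotheses (p_size : (size p <= D.+1)%N) (p1 : p.[1] = 1).
Hypothesis p_flat : forall j, (0 < j)%N -> `|p.[(1 - m.+1%:R^-1) ^+ j]| <= e.
Hypothesis p_coef : forall i, `|p`_i| <= G.
Let B : R := D.+1%:R * G * 2 ^+ D.
Hypotheses (e_gt0 : 0 < e) (eB : e <= B).
Hypothesis N1_ge : B ^+ 2 <= e ^+ 2 * N1%:R.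
Hypothesis N2_ge : 8 * (k%:R * l.+1%:R + 40) * B ^+ 2 <= e ^+ 2 * N2%:R.

(** Bernoulli's inequality with |U| / (m+1) <= 1/2. *)
Lemma half_le_beta (U : {set 'I_l.+1}) : (#|U| <= k)%N ->
  1 / 2 <= (1 - m.+1%:R^-1) ^+ #|U| :> R.
Proof.
move=> Uk; have m0 : 0 < m.+1%:R :> R by rewrite ltr0n.
apply: le_trans (bernoulli_sub _ _); last first.
  by rewrite invr_ge0 ltW // invf_le1 // ler1n.
have : (#|U|.*2)%:R / m.+1%:R <= 1 :> R.
  by rewrite ler_pdivrMr // mul1r ler_nat (leq_trans _ km) // leq_double.
by rewrite -muln2 natrM; move: (m.+1%:R^-1) #|U|%:R => x y; lra.
Qed.

(** Of the error 3e, one e is the flatness of [p], one the bias from sampling inside the absolute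
    value, and one the deviation of the outer average, bounded by Chernoff. *)
Lemma avg_corr_est h f (U : {set 'I_l.+1}) : (#|U| <= k)%N ->
  avg (fun s => (3 * e < `|corr_est h f U s - l1 (cexp (blocks h U) (sgf R f))|)%R%:R)
    <= 2 * expR (- (N2%:R * (e / B) ^+ 2 / 8)).
Proof.
move=> Uk; have B0 : 0 < B by exact: lt_le_trans eB.
have F1 (x : cube n) : `|sgf R f x| <= 1 by rewrite sgf_norm.
have ZB x (w : noise n l D m) : `|estim p h (sgf R f) U x w| <= B.
  by rewrite /B; apply: estim_le => //; exact: half_le_beta.
pose X (t : sample) := `|avg (fun b => estim p h (sgf R f) U t.1 (t.2 b))|.
have XB t : 0 <= X t <= B.
  rewrite normr_ge0 /X; apply: le_trans (ler_norm_avg _) _.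
  by apply: avg_le_const; rewrite ?card_ord.
have EX : `|avg X - l1 (cexp (blocks h U) (sgf R f))| <= 2 * e.
  have flat : `|l1 (fun x => avg (estim (D := D) (m := m) p h (sgf R f) U x)) -
      l1 (cexp (blocks h U) (sgf R f))| <= e.
    apply: estim_flat => //; first exact: ltW.
    apply: avg_le_const; first exact: card_cube_gt0.
    by move=> x; rewrite -real_normK ?num_real // sgf_norm expr1n.
  pose M x := avg (estim (D := D) (m := m) p h (sgf R f) U x).
  have mean : `|avg X - l1 M| <= e.
    rewrite avg_pair /l1 -avgB; apply: le_trans (ler_norm_avg _) _.
    apply: avg_le_const; first exact: card_cube_gt0.
    move=> x; rewrite -[X in _ - X](@avg_const R {ffun 'I_N1 -> noise n l D m});
      last first.
      by rewrite card_ffun expn_gt0 card_noise_gt0.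
    rewrite -avgB; apply: le_trans (ler_norm_avg _) _.
    apply: le_trans (avg_sample_mean card_noise_gt0 N1_gt0 (ZB x) (ltW e_gt0)
      N1_ge).
    by apply: ler_avg => w; exact: ler_dist_dist.
  have := ler_normD (avg X - l1 M) (l1 M - l1 (cexp (blocks h U) (sgf R f))).
  rewrite addrA subrK; move: flat; rewrite -/M; lra.
have tau : 0 < e / B <= 1 by rewrite divr_gt0 //= ler_pdivrMr // mul1r.
have sample0 : (0 < #|{: sample}|)%N.
  by rewrite card_prod muln_gt0 card_cube_gt0 card_ffun expn_gt0 card_noise_gt0.
apply: le_trans (avg_deviation sample0 tau N2_gt0 B0 XB); apply: ler_avg => s.
rewrite ler_nat divfK ?gt_eqF // -[corr_est _ _ _ _]/(avg (fun a => X (s a))).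
have [d3|_] := ltP (3 * e) `|avg (fun a => X (s a)) - l1 (cexp (blocks h U) (sgf R f))|;
  last by [].
suff -> : e < `|avg (fun a => X (s a)) - avg X| by [].
have := ler_normD (avg (fun a => X (s a)) - avg X)
  (avg X - l1 (cexp (blocks h U) (sgf R f))).
rewrite addrA subrK; lra.
Qed.

Lemma avg_corr_est_all h f :
  avg (fun s => (~~ [forall u : {ffun 'I_k -> 'I_l.+1},
      `|corr_est h f (img u) s - l1 (cexp (blocks h (img u)) (sgf R f))| <= 3 * e])%:R)
    <= 1 / 6 :> R.
Proof.
have B0 : 0 < B by exact: lt_le_trans eB.
apply: le_trans (expR_union (x := N2%:R * (e / B) ^+ 2 / 8) _); last first.
  rewrite ler_pdivlMr // expr_div_n mulrA ler_pdivlMr ?exprn_gt0 //.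
  by rewrite [N2%:R * _]mulrC [_ * 8]mulrC.
have sumE (c : R) : #|{ffun 'I_k -> 'I_l.+1}|%:R * c =
    \sum_(u : {ffun 'I_k -> 'I_l.+1}) c by rewrite sumr_const mulr_natl.
rewrite sumE.
pose dev (u : {ffun 'I_k -> 'I_l.+1}) (s : samples) : R :=
  `|corr_est h f (img u) s - l1 (cexp (blocks h (img u)) (sgf R f))|.
apply: (@le_trans _ _ (\sum_(u : {ffun 'I_k -> 'I_l.+1})
    avg (fun s => (3 * e < dev u s)%R%:R))); last first.
  by apply: ler_sum => u _; exact/avg_corr_est/card_img.
rewrite -avg_sum; apply: ler_avg => s.
rewrite -[X in ~~ X]/[forall u : {ffun 'I_k -> 'I_l.+1}, dev u s <= 3 * e].
case: (boolP [forall u : {ffun 'I_k -> 'I_l.+1}, dev u s <= 3 * e]) => [_|].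
  exact: sumr_ge0.
rewrite negb_forall => /existsP[u]; rewrite -ltNge => us.
by rewrite (bigD1 u) //= us lerDl sumr_ge0.
Qed.

(** Hashing and sampling each fail with probability at most 1/6. Otherwise the correlations are off
    by at most e + 3e, and distances are half of that. *)
Lemma estimator_correct : 48 * k.+1%:R ^+ 4 <= l.+1%:R * e ^+ 4 -> e <= 1 ->
  distance_estimator (junta n k) (2 * e) estimator.
Proof.
move=> le e1 f; rewrite prob_estimator.
have [nk|/negPf nk] := boolP ((0 < n)%N || (k == 0)%N); last first.
  have [n0 k0] : n = 0%N /\ (0 < k)%N.
    by move: nk; rewrite !lt0n; case: eqP => //; case: eqP.
  (* Without any index the class is empty, and the minimum takes its default value 1, the output of
     the tree. *)
  have -> : dist_class R f (junta n k) = 1.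
    rewrite /dist_class big_pred0 // => g; apply/existsP => -[i _].
    by have := ltn_ord (i (Ordinal k0)); rewrite [X in (_ < X)%N]n0.
  rewrite (eq_avg (G := fun=> 1)) ?avg_const ?card_seed_gt0 //; first by lra.
  move=> w; rewrite /= /estimator_tree nk /=.
  by rewrite subrr normr0 mulr_ge0 // ltW.
pose good1 h := [forall u : {ffun 'I_k -> 'I_l.+1}, exists i : {ffun 'I_k -> 'I_n},
  l1 (cexp (blocks h (img u)) (sgf R f)) <= l1 (cexp (img i) (sgf R f)) + e].
pose good2 h s := [forall u : {ffun 'I_k -> 'I_l.+1},
  `|corr_est h f (img u) s - l1 (cexp (blocks h (img u)) (sgf R f))| <= 3 * e].
have bad1 : avg (fun h => (~~ good1 h)%:R) <= 1 / 6 :> R.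
  apply: hashing_good => //; last by rewrite e_gt0.
  apply: avg_le_const; first exact: card_cube_gt0.
  by move=> x; rewrite -real_normK ?num_real // sgf_norm expr1n.
have bad2 h : avg (fun s => (~~ good2 h s)%:R) <= 1 / 6 :> R.
  exact: avg_corr_est_all.
have h0 : (0 < #|{ffun 'I_n -> 'I_l.+1}|)%N by rewrite card_ffun expn_gt0 card_ord.
have s0 : (0 < #|samples|)%N.
  rewrite card_ffun expn_gt0 card_prod muln_gt0 card_cube_gt0.
  by rewrite card_ffun expn_gt0 card_noise_gt0.
apply: (@le_trans _ _ (1 - (avg (fun h => (~~ good1 h)%:R) +
    avg (fun h => avg (fun s => (~~ good2 h s)%:R))))).
  have : avg (fun h => avg (fun s => (~~ good2 h s)%:R)) <= 1 / 6 :> R.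
    exact: avg_le_const.
  by move: bad1; lra.
rewrite -avgD -[X in X - _](avg_const _ h0) -avgB avg_pair; apply: ler_avg => h.
rewrite opprD addrA.
have -> : 1 - (~~ good1 h)%:R - avg (fun s => (~~ good2 h s)%:R) =
   avg (fun s => 1 - (~~ good1 h)%:R - (~~ good2 h s)%:R) :> R.
  by rewrite avgB avg_const.
apply: ler_avg => s.
case: (boolP (good1 h)) => [/forallP g1|_]; last first.
  by rewrite subrr sub0r; apply: le_trans (_ : 0 <= _) => //; rewrite oppr_le0.
case: (boolP (good2 h s)) => [/forallP g2|_]; last by rewrite subr0 subrr.
rewrite !subr0; suff -> : `|run (estimator_tree (h, s)) f -
   dist_class R f (junta n k)| <= 2 * e by [].
rewrite run_estimator //=; apply: dist_class_close.
  move=> g /(junta_dist_ge R f)[i ig].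
  (* The blocks of the junta's own indices contain those indices, so their correlation is at least
     as large. *)
  pose u : {ffun 'I_k -> 'I_l.+1} := [ffun a => h (i a)].
  have := l1_cexp_mono (sgf R f) (blocks_img h i); rewrite -/u.
  have : corr_est h f (img u) s <= max_corr h s f.
    exact: (le_bigmax 0 (fun u : {ffun 'I_k -> 'I_l.+1} => corr_est h f (img u) s) u).
  have := g2 u; rewrite ler_distl => /andP[+ _]; move: ig e_gt0; lra.
have [u uM] : exists u : {ffun 'I_k -> 'I_l.+1}, max_corr h s f = corr_est h f (img u) s.
  (* Nonnegativity makes the default 0 of the maximum neutral, so the maximum is attained. *)
  have corr_ge0 (u : {ffun 'I_k -> 'I_l.+1}) : predT u ->
    0 <= corr_est h f (img u) s by move=> _; exact: avg_ge0.
  have [u _ uE] := eq_bigmax [ffun=> ord0] predT _ isT corr_ge0.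
  by exists u; exact: uE.
have /existsP[i ui] := g1 u.
have [g gi gd] := junta_dist_attained R f i.
exists g => //; rewrite gd uM.
have := g2 u; rewrite ler_distl => /andP[]; move: ui e_gt0; lra.
Qed.

End Estimator.

Lemma leq_expn2 a b i : (a <= b -> a ^ i <= b ^ i)%N.
Proof. by case: i => // i ab; rewrite leq_exp2r. Qed.

(** * Choice of the parameters and the resulting number of queries *)

Section SampleSizes.
Variables k L : nat.

(** With s roots the Chebyshev scale is about sqrt (k / s) and about L + s log k bits must be
    gained. Taking s = L balances the two summands up to log k; s = k suffices when L is larger, as
    the scale is then bounded. *)
Definition num_roots := minn k L.

Lemma cheb_scale_exists : exists q, (2 * k.+1 <= q ^ 2 * num_roots.+1)%N.
Proof. by exists (2 * k.+1)%N; rewrite -mulnA leq_pmulr // muln_gt0. Qed.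

Definition cheb_scale := ex_minn cheb_scale_exists.

Definition root_bits := up_log 2 (2 * k.+1).
Definition cheb_bits := (L + 2 + num_roots * root_bits)%N.
Definition flat_degree := (num_roots + cheb_scale * cheb_bits)%N.

Lemma cheb_scaleP : [/\ (0 < cheb_scale)%N,
  (2 * k.+1 <= cheb_scale ^ 2 * num_roots.+1)%N &
  (cheb_scale.-1 ^ 2 * num_roots.+1 < 2 * k.+1)%N].
Proof.
rewrite /cheb_scale; case: ex_minnP => q qk qmin.
have q0 : (0 < q)%N by case: q qk {qmin}.
split=> //; rewrite ltnNge; apply/negP => /qmin.
by rewrite leqNgt ltn_predL q0.
Qed.

Definition coef_bound :=
  ((2 * (2 * k.+1)) ^ num_roots * 7 ^ (cheb_scale * cheb_bits))%N.
Definition estim_bound := (flat_degree.+1 * coef_bound * 2 ^ flat_degree)%N.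
(** The bound 48 (k+1)^4 / e^4 of [hashing_good] at e = 2^-(L+1). The next two counts meet [N1_ge]
    and [N2_ge] for the same e. *)
Definition num_blocks := (48 * k.+1 ^ 4 * 2 ^ (4 * L.+1))%N.
Definition num_inner := (estim_bound ^ 2 * 2 ^ (2 * L.+1))%N.
Definition num_outer :=
  (8 * (k * num_blocks.+1 + 40) * estim_bound ^ 2 * 2 ^ (2 * L.+1))%N.

Lemma estim_bound_gt0 : (0 < estim_bound)%N.
Proof. by rewrite /estim_bound /coef_bound !muln_gt0 !expn_gt0. Qed.

Lemma estim_bound_le : (estim_bound <= 2 ^ (7 * flat_degree))%N.
Proof.
have [q0 _ _] := cheb_scaleP; set D := flat_degree.
have roots_bits : (num_roots * root_bits + num_roots <= 2 * D)%N.
  have : (cheb_bits <= cheb_scale * cheb_bits)%N by rewrite leq_pmull.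
  rewrite /D /flat_degree {1}/cheb_bits; lia.
have qB : (cheb_scale * cheb_bits <= D)%N by rewrite leq_addl.
have c1 : ((2 * (2 * k.+1)) ^ num_roots <= 2 ^ (2 * D))%N.
  apply: leq_trans (_ : (2 ^ (1 + root_bits)) ^ num_roots <= _)%N.
    by rewrite leq_expn2 // expnD leq_mul // up_logP.
  by rewrite -expnM leq_exp2l // mulnC mulnDr muln1 addnC.
have c2 : (7 ^ (cheb_scale * cheb_bits) <= 2 ^ (3 * D))%N.
  apply: leq_trans (_ : (2 ^ 3) ^ (cheb_scale * cheb_bits) <= _)%N.
    exact: leq_expn2.
  by rewrite -expnM leq_exp2l // leq_mul.
have -> : (7 * D = D + (2 * D + 3 * D) + D)%N by lia.
have c0 : (flat_degree.+1 <= 2 ^ D)%N by exact: ltn_expl.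
rewrite expnD [(2 ^ (_ + (_ + _)))%N]expnD [(2 ^ (2 * D + _))%N]expnD.
exact: leq_mul (leq_mul c0 (leq_mul c1 c2)) (leqnn _).
Qed.

(** The fourth power of [estim_bound] gives 28 = 4 * 7; the blocks and the two factors 1/e^2 give 8
    (L+1). *)
Lemma num_queries_le :
  (num_outer * num_inner <= k.+1 ^ 5 * 2 ^ (22 + 8 * L + 28 * flat_degree))%N.
Proof.
have -> : (num_outer * num_inner = (k * num_blocks.+1 + 40) *
    (2 ^ 3 * 2 ^ (4 * L.+1) * estim_bound ^ 4))%N.
  rewrite /num_outer /num_inner (_ : 4 * L.+1 = 2 * L.+1 + 2 * L.+1)%N; last by lia.
  by rewrite expnD (_ : 8 = 2 ^ 3)%N //; ring.
have blocks_le : (k * num_blocks.+1 + 40 <= k.+1 ^ 5 * 2 ^ (11 + 4 * L.+1))%N.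
  pose w := (k.+1 ^ 4 * 2 ^ (4 * L.+1))%N.
  have w0 : (0 < w)%N by rewrite muln_gt0 !expn_gt0.
  have -> : num_blocks = (48 * w)%N by rewrite /num_blocks /w mulnA.
  have -> : (k.+1 ^ 5 * 2 ^ (11 + 4 * L.+1) = k.+1 * (2048 * w))%N.
    by rewrite expnS expnD (_ : 2 ^ 11 = 2048)%N // -mulnA [(k.+1 ^ 4 * _)%N]mulnCA -/w.
  have := leq_pmulr k w0; clearbody w.
  by nia.
apply: leq_trans (leq_mul blocks_le (leqnn _)) _; rewrite -mulnA leq_mul //.
apply: leq_trans (_ : 2 ^ (11 + 4 * L.+1) * (2 ^ 3 * 2 ^ (4 * L.+1) *
    (2 ^ (7 * flat_degree)) ^ 4) <= _)%N.
  apply: leq_mul => //; apply: leq_mul => //.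
  exact/leq_expn2/estim_bound_le.
by rewrite -expnM -!expnD leq_exp2l //; lia.
Qed.

End SampleSizes.

Lemma estimator_exists (R : realType) (n k L : nat) :
  exists A : rand_algo R n, [/\
    distance_estimator (junta n k) (2 ^- L) A, nonadaptive A &
    makes_at_most A (k.+1 ^ 5 * 2 ^ (22 + 8 * L + 28 * flat_degree k L))%:R].
Proof.
have [q0 qk _] := cheb_scaleP k L.
set s := num_roots k L in qk *; set q := cheb_scale k L in q0 qk *.
have sk : (s.+1 <= 2 * k.+1)%N by rewrite /s /num_roots; lia.
have bits : (2 ^ (L + 2) * (2 * k.+1) ^ s <= 2 ^ cheb_bits k L)%N.
  rewrite /cheb_bits -/s [(2 ^ (_ + s * _))%N]expnD leq_mul //.
  by rewrite [(s * _)%N]mulnC expnM leq_expn2 // up_logP.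
have [p [p_size p1 p_flat p_coef]] := flat_poly R (isT : (0 < 2 * k.+1)%N) q0 sk qk bits.
have B0 : (0 < estim_bound k L)%N := estim_bound_gt0 k L.
have BE : (flat_degree k L).+1%:R * (coef_bound k L)%:R * 2 ^+ flat_degree k L =
    (estim_bound k L)%:R :> R by rewrite /estim_bound 2!natrM natrX.
(* Half the target accuracy, since the estimator errs by up to 2e. *)
pose e : R := 2 ^- L.+1.
have e0 : 0 < e by rewrite invr_gt0 exprn_gt0.
have e1 : e <= 1 by rewrite invf_le1 ?exprn_gt0 // exprn_ege1 // ler1n.
have ek j : e ^+ j * (2 ^ (j * L.+1))%:R = 1.
  by rewrite natrX mulnC exprM -exprMn mulVf ?expr1n // gt_eqF // exprn_gt0.
(* The dice have [m.+1] faces, hence the predecessor: beta = 1 - 1/(2k+2) as in [flat_poly]. *)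
exists (@estimator R n (num_blocks k L) k (flat_degree k L) (2 * k.+1).-1
  (num_inner k L) (num_outer k L) p).
have m_pos : (0 < (2 * k.+1).-1)%N by lia.
have km : (k.*2 <= (2 * k.+1).-1.+1)%N by rewrite -mul2n; lia.
have Ni : (0 < num_inner k L)%N by rewrite muln_gt0 !expn_gt0 B0.
have No : (0 < num_outer k L)%N 
  by rewrite muln_gt0 !expn_gt0 andbT muln_gt0 expn_gt0 B0 andbT muln_gt0 addn_gt0 orbT.
split.
- have -> : 2 ^- L = 2 * e :> R by rewrite /e exprS invfM mulrA mulfV ?mul1r ?pnatr_eq0.
  apply: (estimator_correct m_pos km Ni No p_size p1 p_flat p_coef e0) => //.
  + by rewrite BE (le_trans e1) // ler1n.
  + have -> : (num_inner k L)%:R =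
        (estim_bound k L)%:R ^+ 2 * (2 ^ (2 * L.+1))%:R :> R.
      by rewrite -[in RHS]natrX -natrM.
    by rewrite BE mulrCA ek mulr1.
  + have -> : (num_outer k L)%:R = 8 * (k%:R * (num_blocks k L).+1%:R + 40) *
        (estim_bound k L)%:R ^+ 2 * (2 ^ (2 * L.+1))%:R :> R.
      by rewrite -natrX -natrM -natrD -!natrM.
    by rewrite BE [leRHS]mulrCA ek mulr1.
  + have -> : (num_blocks k L).+1%:R =
        48 * k.+1%:R ^+ 4 * (2 ^ (4 * L.+1))%:R + 1 :> R.
      by rewrite -natrX -!natrM natr1.
    rewrite [leRHS]mulrDl -[X in _ <= X + _]mulrA [_%:R * e ^+ 4]mulrC.
    rewrite ek mulr1 mul1r lerDl.
    by rewrite exprn_ge0 // ltW.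
- exact: estimator_nonadaptive.
- move=> w f; rewrite ler_nat; apply: leq_trans (num_queries_le k L).
  exact: estimator_queries.
Qed.

(** * The query count in terms of k and eps *)

Section QueryCount.
Variable R : realType.
Implicit Types (k L a : nat) (lam : R).

Lemma ln2_gt0 : 0 < ln 2 :> R.
Proof. by rewrite ln_gt0 // ltr1n. Qed.

Lemma log2_exp2 a : log2 (2 ^+ a : R) = a%:R.
Proof.
by rewrite /log2 lnXn ?ltr0n // -[_ *+ a]mulr_natr mulrAC mulfV ?mul1r ?gt_eqF ?ln2_gt0.
Qed.

Lemma ler_log2 (x y : R) : 0 < x -> x <= y -> log2 x <= log2 y.
Proof.
move=> x0 xy; rewrite /log2 ler_wpM2r ?invr_ge0 ?(ltW ln2_gt0) //.
by rewrite ler_ln ?posrE // (lt_le_trans x0).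
Qed.

Lemma log2M (x y : R) : 0 < x -> 0 < y -> log2 (x * y) = log2 x + log2 y.
Proof. by move=> x0 y0; rewrite /log2 lnM ?posrE // mulrDl. Qed.

Lemma log2_ge0 (x : R) : 1 <= x -> 0 <= log2 x.
Proof. by move=> x1; have := ler_log2 ltr01 x1; rewrite -(expr0 2) log2_exp2. Qed.

Lemma log2_nat_ge0 k : 0 <= log2 (k%:R : R).
Proof.
case: k => [|k]; first by rewrite /log2 ln0 ?mul0r.
by rewrite log2_ge0 // ler1n.
Qed.

(** For t bits, 2^(t-1) < 2(k+1) <= 4k, so t <= 3 + log2 k. *)
Lemma root_bits_le k : (0 < k)%N -> (root_bits k)%:R <= 3 * (1 + log2 k%:R) :> R.
Proof.
move=> k0; have kR : 0 < k%:R :> R by rewrite ltr0n.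
have M1 : (1 < 2 * k.+1)%N by lia.
have /andP[tk _] := up_log_bounds (isT : (1 < 2)%N) M1.
have : log2 (2 ^+ (root_bits k).-1 : R) <= log2 (2 ^+ 2 * k%:R).
  apply: ler_log2; first by rewrite exprn_gt0.
  rewrite -!natrX -natrM ler_nat; apply: leq_trans (ltnW tk) _; lia.
rewrite log2M ?exprn_gt0 // !log2_exp2.
have := log2_nat_ge0 k; case: (root_bits k) => [|t] /=; first by lra.
by rewrite -natr1; lra.
Qed.

(** The square is at most 4kL <= 8 k lam <= 9 k lam. *)
Lemma nat_le_sqrt k L a lam : 0 <= lam -> L%:R <= 2 * lam ->
  (a ^ 2 <= 4 * (k * L))%N -> a%:R <= 3 * Num.sqrt (k%:R * lam).
Proof.
move=> lam0 Llam aL; have kl : 0 <= k%:R * lam by rewrite mulr_ge0.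
rewrite -(@ler_pXn2r _ 2) ?nnegrE ?mulr_ge0 ?sqrtr_ge0 // exprMn sqr_sqrtr //.
have : (a ^ 2)%:R <= (4 * (k * L))%:R :> R by rewrite ler_nat.
have : k%:R * L%:R <= k%:R * (2 * lam) by rewrite ler_wpM2l.
rewrite natrX !natrM; lra.
Qed.

(** Minimality of the scale q gives (q-1)^2 (s+1) < 2(k+1), so q is split as (q-1) + 1. If L <= k
    then s = L and (q-1) L is of order sqrt (kL); otherwise s = k and q - 1 <= 1. *)
Lemma flat_degree_le k L lam : (0 < L)%N -> 0 <= lam -> L%:R <= 2 * lam ->
  (flat_degree k L)%:R <=
    6 * L%:R + 30 * Num.sqrt (k%:R * lam) * (1 + log2 k%:R).
Proof.
move=> L0 lam0 Llam; have [q0 _ q1] := cheb_scaleP k L.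
have sk : (num_roots k L <= k)%N by rewrite geq_minl.
have sL : (num_roots k L <= L)%N by rewrite geq_minr.
rewrite /flat_degree /cheb_bits; move: (root_bits_le (k := k)).
set s := num_roots k L in q1 sk sL *; set q := cheb_scale k L in q0 q1 *.
set t := root_bits k; set r := Num.sqrt _; set w := 1 + log2 k%:R => tw.
have r0 : 0 <= r by rewrite sqrtr_ge0.
have w1 : 1 <= w by rewrite lerDl log2_nat_ge0.
have s_r : s%:R <= 3 * r.
  apply: (nat_le_sqrt lam0 Llam); rewrite -mulnn.
  by apply: leq_trans (leq_mul sk sL) _; rewrite leq_pmull.
have qs_r : (q.-1 * s)%:R <= 3 * r.
  by apply: (nat_le_sqrt lam0 Llam); rewrite expnMn; nia.
have qL_r : (q.-1 * L)%:R <= L%:R + 3 * r.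
  have [Lk|kL] := leqP L k.
    have sE : s = L by rewrite /s /num_roots (minn_idPr Lk).
    by move: qs_r; rewrite sE; have : 0 <= L%:R :> R by []; lra.
  have sE : s = k by rewrite /s /num_roots (minn_idPl (ltnW kL)).
  have q2 : (q.-1 <= 1)%N by rewrite sE in q1; nia.
  have : (q.-1 * L)%:R <= L%:R :> R.
    by rewrite ler_nat -[leqRHS]mul1n leq_mul.
  by lra.
have st : s%:R * t%:R <= s%:R * (3 * w) /\
    (q.-1 * s)%:R * t%:R <= (q.-1 * s)%:R * (3 * w).
  have [k0|k0] := posnP k; last by split; rewrite ler_wpM2l // tw.
  have -> : s = 0%N by apply/eqP; rewrite -leqn0 -k0.
  by rewrite muln0 !mul0r.
have L1 : 1 <= L%:R :> R by rewrite ler1n.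
have rw : r <= r * w by rewrite ler_peMr.
have -> : (s + q * (L + 2 + s * t))%N =
  (s + (q.-1 * L + L) + (q.-1 * 2 + 2) + (q.-1 * s * t + s * t))%N.
  by rewrite -{1}(prednK q0); lia.
have q2L : (q.-1 * 2)%:R <= 2 * (q.-1 * L)%:R :> R.
  by rewrite mulnC natrM ler_wpM2l // ler_nat leq_pmulr.
have sw : s%:R * (3 * w) <= 3 * r * (3 * w).
  by rewrite ler_wpM2r //; lra.
have qsw : (q.-1 * s)%:R * (3 * w) <= 3 * r * (3 * w).
  by rewrite ler_wpM2r //; lra.
rewrite !natrD [(q.-1 * s * t)%:R]natrM [(s * t)%:R]natrM.
move: st => [st1 st2].
move: s_r qs_r qL_r st1 st2 q2L sw qsw L1 rw.
have -> : 3 * r * (3 * w) = 9 * (r * w) by ring.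
have -> : 30 * r * w = 30 * (r * w) by ring.
move: (q.-1 * L)%:R (q.-1 * 2)%:R (s%:R * t%:R) ((q.-1 * s)%:R * t%:R) => a b c d.
move: (s%:R * (3 * w)) ((q.-1 * s)%:R * (3 * w)) (r * w) L%:R s%:R => a' b' c' d' e'.
lra.
Qed.

(** Exponent of a power of two between x and 2x, rounding the accuracy 1/x down to a dyadic one. The
    successor compensates for truncation. *)
Definition accuracy (x : R) : nat := up_log 2 (Num.truncn x).+1.

Lemma accuracyP (x : R) : 2 <= x ->
  [/\ (0 < accuracy x)%N, x <= 2 ^+ accuracy x & 2 ^+ accuracy x <= 2 * x].
Proof.
move=> x2; have x0 : 0 <= x by lra.
have /andP[tx xt] := truncn_itv x0.
have t2 : (2 <= Num.truncn x)%N.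
  by rewrite -ltnS -(ltr_nat R); apply: le_lt_trans xt.
have t1 : (1 < (Num.truncn x).+1)%N by rewrite ltnW.
have /andP[] := up_log_bounds (isT : (1 < 2)%N) t1.
rewrite -/(accuracy x) => lo hi.
have L0 : (0 < accuracy x)%N by rewrite lt0n; apply: contraTneq hi => ->; lia.
split=> //.
  by apply: le_trans (ltW xt) _; rewrite -natrX ler_nat.
rewrite -(prednK L0) exprS ler_pM2l // -natrX.
by apply: le_trans tx; rewrite ler_nat -ltnS.
Qed.

Lemma query_count k (eps : R) (L := accuracy eps^-1) : 0 < eps <= 1 / 2 ->
  (k.+1 ^ 5 * 2 ^ (22 + 8 * L + 28 * flat_degree k L))%:R <=
    poly_factor 379 k eps * 2 `^ soft_exponent 840 1 k eps.
Proof.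
move=> /andP[e0 e2].
have x2 : 2 <= eps^-1 by rewrite -[2]invrK lef_pV2 ?posrE ?invr_gt0 //; lra.
have [L0 xL Lx] := accuracyP x2; rewrite -/L in L0 xL Lx.
set x := eps^-1 in x2 xL Lx *; set lam := log2 x.
have x0 : 0 < x by lra.
have lam1 : 1 <= lam by have := ler_log2 (ltr0Sn R 1) x2; rewrite -[2]expr1 log2_exp2.
have Llam : L%:R <= 2 * lam.
  have := ler_log2 (exprn_gt0 L (ltr0Sn R 1)) Lx.
  rewrite -{2}[2]expr1 log2M ?expr1 // -{2}[2]expr1 !log2_exp2 -/lam; lra.
set P : R := k%:R + x.
have P2 : 2 <= P by rewrite /P; have : 0 <= k%:R :> R by []; lra.
have P1 : 1 <= P by lra.
have kP : k.+1%:R <= P by rewrite -natr1 /P; lra.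
have LP : 2 ^+ L <= P ^+ 2.
  apply: le_trans Lx _; rewrite expr2 ler_pM //; first by lra.
  by rewrite /P lerDr.
pose r := Num.sqrt (k%:R * lam); pose w : R := 1 + log2 k%:R.
have deg := flat_degree_le k L0 (le_trans ler01 lam1) Llam.
rewrite -/r -/w in deg.
have r0 : 0 <= r by rewrite sqrtr_ge0.
rewrite /poly_factor /soft_exponent -/x -/P -/lam -/r expr1.
set z := 840%:R * r * _.
have wz : 840 * r * w <= z.
  rewrite /z ler_wpM2l ?mulr_ge0 // /w -addrA [leRHS]addrA lerDl.
  exact: log2_ge0.
have -> : (k.+1 ^ 5 * 2 ^ (22 + 8 * L + 28 * flat_degree k L))%:R =
    k.+1%:R ^+ 5 * (2 ^+ 22 * (2 ^+ L) ^+ 8) * 2 `^ (28 * (flat_degree k L)%:R) :> R.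
  rewrite -[28 * _]natrM powR_mulrn // [LHS]natrM !natrX -[RHS]mulrA.
  congr (_ * _); rewrite -[(2 ^+ L) ^+ 8]exprM -!exprD; congr (_ ^+ _).
  by rewrite [(L * 8)%N]mulnC.
(* In order: (k+1)^5; 2^22; (2^L)^8 with 2^L <= 2x <= P^2; and 2^(168 L), where 168 = 28 * 6 comes
   from the L term of the degree. The other term gives 840 = 28 * 30. *)
have -> : 379%N = (5 + (22 + 2 * 8) + 2 * 168)%N by [].
apply: (@le_trans _ _ (P ^+ 5 * (P ^+ 22 * (P ^+ 2) ^+ 8) *
    ((P ^+ 2) ^+ 168 * 2 `^ z))); last first.
  by rewrite -!exprM -!exprD mulrA -exprD.
have mono (u v : R) i : 0 <= u -> u <= v -> u ^+ i <= v ^+ i.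
  by move=> u0 uv; rewrite lerXn2r ?nnegrE // (le_trans u0).
apply: ler_pM; rewrite ?powR_ge0 ?mulr_ge0 ?exprn_ge0 //.
  apply: ler_pM; rewrite ?mulr_ge0 ?exprn_ge0 ?mono //.
  by apply: ler_pM; rewrite ?exprn_ge0 ?mono ?exprn_ge0.
apply: (@le_trans _ _ (2 `^ (168 * L%:R + z))).
  by rewrite ler_powR ?ler1n //; lra.
rewrite powRD; last by apply/implyP => _; rewrite pnatr_eq0.
rewrite ler_pM ?powR_ge0 // -natrM powR_mulrn // mulnC exprM.
by rewrite mono ?exprn_ge0.
Qed.

End QueryCount.

Theorem theorem1p2 (R : realType) :
  exists (a b c : nat) (A : forall n k : nat, R -> rand_algo R n),
  forall (n k : nat) (eps : R), 0 < eps <= 1 / 2 ->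
    [/\ distance_estimator (junta n k) eps (A n k eps),
        nonadaptive (A n k eps) &
        makes_at_most (A n k eps)
          (poly_factor a k eps * 2 `^ soft_exponent b c k eps)].
Proof.
exists 379%N, 840%N, 1%N.
exists (fun n k eps => sval (cid (estimator_exists R n k (accuracy eps^-1)))).
move=> n k eps eps12; case: cid => A /= [Aest Anon Aqueries].
split=> //; last first.
  by move=> w f; apply: le_trans (Aqueries w f) _; exact: query_count.
have /andP[e0 e2] := eps12.
have x2 : 2 <= eps^-1 by rewrite -[2]invrK lef_pV2 ?posrE ?invr_gt0 //; lra.
have [_ xL _] := accuracyP x2.
(* As 2^-L <= eps, success at accuracy 2^-L implies success at accuracy eps. *)
move=> f; apply: le_trans (Aest f) _; rewrite /prob big_mkcond [leRHS]big_mkcond.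
apply: ler_sum => w _; case: ifP => [close|_]; last first.
  by case: ifP => // _; exact: weight_ge0.
rewrite ifT //; apply: le_trans close _.
by rewrite -[leRHS]invrK lef_pV2 ?posrE ?invr_gt0 ?exprn_gt0.
Qed.
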